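(* Let $X$ be the intersection of finitely many pairwise distinct closed polynomial half planes (not necessarily connected or simply connected). Then there exists a cell decomposition of $X$ such that every shortest-length curve between two points of $X$ interacts with each cell at most finitely many times.
   Context: For a real polynomial $p$ and angle $\theta$, $\Phi_{p,\theta}(x,y)=p(x\cos\theta+y\sin\theta)-(-x\sin\theta+y\cos\theta)$; a closed polynomial half plane is a set $\{\Phi_{p,\theta}\ge0\}$. A shortest-length curve between $A$ and $B$ in $X$ is a continuous piecewise $C^2$ curve in $X$ from $A$ to $B$ of minimal length $\int|\gamma'|$ among all piecewise $C^2$ curves in $X$ from $A$ to $B$. A cell decomposition of $X$ is a partition of $X$ into at most countably many pairwise disjoint cells, each homeomorphic to $\mathbb{R}^d$, $d\in\{0,1,2\}$. A curve $\gamma$ interacts with a set $e$ at most $N$ times if $\gamma^{-1}(e)$ has at most $N$ connected components. *)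

(* Defs.v *)
From HB Require Import structures.
From mathcomp Require Import all_boot all_order all_algebra.
From mathcomp Require Import all_classical all_reals all_analysis.
Set Implicit Arguments. Unset Strict Implicit. Unset Printing Implicit Defensive.
Import Order.TTheory GRing.Theory Num.Theory.
Import numFieldNormedType.Exports.
Local Open Scope classical_set_scope.
Local Open Scope ring_scope.

Section Defs.
Variable R : realType.

Definition Phi (p : {poly R}) (th : R) (z : R * R) : R :=
  p.[z.1 * cos th + z.2 * sin th] - (- z.1 * sin th + z.2 * cos th).

Definition poly_half_plane (p : {poly R}) (th : R) : set (R * R) :=
  [set z | 0 <= Phi p th z].

Definition is_closed_poly_half_plane (H : set (R * R)) : Prop :=
  exists (p : {poly R}) (th : R), H = poly_half_plane p th.

Definition homeomorphic_to_Rd (d : nat) (e : set (R * R)) : Prop :=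
  exists (f : 'rV[R]_d -> R * R) (g : R * R -> 'rV[R]_d),
    [/\ continuous f, f @` setT = e, (forall v, g (f v) = v)
      & {within e, continuous g}].

Definition is_cell (e : set (R * R)) : Prop :=
  exists2 d : nat, (d <= 2)%N & homeomorphic_to_Rd d e.

Definition cell_decomposition (X : set (R * R)) (C : set (set (R * R))) : Prop :=
  [/\ countable C,
      (forall e, C e -> is_cell e),
      (forall e1 e2, C e1 -> C e2 -> e1 <> e2 -> e1 `&` e2 = set0)
    & \bigcup_(e in C) e = X].

Definition C2_fun (g : R -> R * R) : Prop :=
  let g1 := fun t => (g t).1 in
  let g2 := fun t => (g t).2 in
  [/\ (forall t, derivable g1 t 1), (forall t, derivable (derive1 g1) t 1)
    & continuous (derive1 (derive1 g1))] /\
  [/\ (forall t, derivable g2 t 1), (forall t, derivable (derive1 g2) t 1)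
    & continuous (derive1 (derive1 g2))].

(* gamma : [a,b] -> R^2 is piecewise C^2: there is a subdivision
   a = s_0 < s_1 < ... < s_n = b such that on each [s_i, s_{i+1}] gamma agrees
   with a C^2 function (i.e. is C^2 up to the endpoints). *)
Definition piecewise_C2 (gamma : R -> R * R) (a b : R) : Prop :=
  exists (n : nat) (s : nat -> R),
    [/\ s 0%N = a, s n = b,
        (forall i, (i < n)%N -> s i < s i.+1)
      & forall i, (i < n)%N -> exists g : R -> R * R,
          C2_fun g /\ forall t, s i <= t <= s i.+1 -> gamma t = g t].

Definition speed (gamma : R -> R * R) (t : R) : R :=
  Num.sqrt (derive1 (fun u => (gamma u).1) t ^+ 2 +
            derive1 (fun u => (gamma u).2) t ^+ 2).

(* length = \int_a^b |gamma'| (Lebesgue integral; derivative exists a.e.) *)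
Definition curve_length (gamma : R -> R * R) (a b : R) : \bar R :=
  (\int[lebesgue_measure]_(t in `[a, b]) (speed gamma t)%:E)%E.

Definition admissible_curve (X : set (R * R)) (A B : R * R)
    (gamma : R -> R * R) (a b : R) : Prop :=
  [/\ a < b, {within `[a, b], continuous gamma}, piecewise_C2 gamma a b
    & forall t, a <= t <= b -> X (gamma t)] /\ (gamma a = A /\ gamma b = B).

Definition shortest_curve (X : set (R * R)) (A B : R * R)
    (gamma : R -> R * R) (a b : R) : Prop :=
  admissible_curve X A B gamma a b /\
  forall (delta : R -> R * R) (c d : R), admissible_curve X A B delta c d ->
    (curve_length gamma a b <= curve_length delta c d)%E.

Definition interacts_finitely (gamma : R -> R * R) (a b : R)
    (e : set (R * R)) : Prop :=
  let S := [set t | a <= t <= b /\ e (gamma t)] in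
  finite_set (connected_component S @` S).

End Defs.

(* Main.v *)
(** Countably many cells are allowed, so they can be taken small.

    If a shortest curve joins two of its points whose chord lies in X, then
    between them it runs along that chord (comparison with the chord and the
    equality case of the triangle inequality).  Hence a convex cell is met in an
    interval of times, and the open set where all Phi_i are positive may be cut
    into maximal dyadic squares, edges and vertices.

    On the boundary curve Gam_i of the i-th half plane every other Phi_j
    restricts to a polynomial, so finitely many points cut Gam_i into arcs on
    which p_i'' and each Phi_j either vanish identically or have no zero.  These
    arcs are cut further into maximal dyadic arcs that are small enough for the
    following analysis.
    - p_i'' = 0: the arc is a segment.
    - Some Phi_j is - Phi_i: then X lies on Gam_i, and a shortest curve runs
      monotonically along it.
    - p_i'' < 0: chords of the arc lie in X, and a line meets a strictly concave
      graph at most twice, so the curve meets the arc in at most two points.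
    - p_i'' > 0: comparison with the arc keeps the curve near the arc between two
      visits.  If it left Gam_i there, Phi_i would have a positive maximum along
      it at an interior point of X, near which the curve is straight; but Phi_i
      has no interior maximum on a segment, being strictly quasiconvex.
    If Phi_j vanishes on Gam_i and p_i'' <> 0, comparing degrees shows that
    Phi_j = Phi_i or Phi_j = - Phi_i, so the cases are exhaustive. *)

Require Import Defs.
From HB Require Import structures.
From mathcomp Require Import all_boot all_order all_algebra.
From mathcomp Require Import all_classical all_reals all_analysis.
From mathcomp Require Import ring lra.
From mathcomp Require Import measurable_realfun polyrcf polyorder.
Set Implicit Arguments.
Unset Strict Implicit.
Unset Printing Implicit Defensive.
Import Order.TTheory GRing.Theory Num.Theory.
Import numFieldNormedType.Exports.
Local Open Scope classical_set_scope.
Local Open Scope ring_scope.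

(** * Euclidean norm and segments *)

Section EuclideanNorm.
Variable R : realType.
Implicit Types (z w : R * R).

(** The norm carried by the product type is the maximum norm, so the Euclidean one is introduced
    separately. *)
Definition enorm z : R := Num.sqrt (z.1 ^+ 2 + z.2 ^+ 2).

Lemma enorm_ge0 z : 0 <= enorm z.
Proof. exact: sqrtr_ge0. Qed.

Lemma enorm_sqr z : enorm z ^+ 2 = z.1 ^+ 2 + z.2 ^+ 2.
Proof. by rewrite sqr_sqrtr// addr_ge0// sqr_ge0. Qed.

Lemma enorm_le z (c : R) : 0 <= c -> z.1 ^+ 2 + z.2 ^+ 2 <= c ^+ 2 -> enorm z <= c.
Proof.
by move=> c0 h; rewrite -(@ler_pXn2r _ 2%N)// ?nnegrE ?enorm_ge0// enorm_sqr.
Qed.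

Lemma enorm_eq0 z : enorm z = 0 -> z = 0.
Proof.
move=> z0; have := enorm_sqr z; rewrite z0 expr0n/= => /esym/eqP.
rewrite paddr_eq0 ?sqr_ge0// !sqrf_eq0 => /andP[/eqP z1 /eqP z2].
by case: z z1 z2 {z0} => x y /= -> ->.
Qed.

Lemma dot_le_enorm z w : z.1 * w.1 + z.2 * w.2 <= enorm z * enorm w.
Proof.
have [h|h] := leP (z.1 * w.1 + z.2 * w.2) 0.
  by apply: (le_trans h); rewrite mulr_ge0 ?enorm_ge0.
rewrite -(@ler_pXn2r _ 2%N)// ?nnegrE ?mulr_ge0 ?enorm_ge0 ?(ltW h)//.
rewrite exprMn !enorm_sqr -subr_ge0.
rewrite [leRHS](_ : _ = (z.1 * w.2 - z.2 * w.1) ^+ 2) ?sqr_ge0//; ring.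
Qed.

Lemma ler_enormD z w : enorm (z + w) <= enorm z + enorm w.
Proof.
apply: enorm_le; first by rewrite addr_ge0 ?enorm_ge0.
have := dot_le_enorm z w; have := enorm_sqr z; have := enorm_sqr w.
rewrite /=; set a := enorm z; set b := enorm w => /= hb ha h.
rewrite [leRHS](_ : _ = a ^+ 2 + b ^+ 2 + (a * b) *+ 2); last by ring.
rewrite ha hb; lra.
Qed.

Lemma enormN z : enorm (- z) = enorm z.
Proof. by rewrite /enorm /= !sqrrN. Qed.

Lemma enormB z w : enorm (z - w) = enorm (w - z).
Proof. by rewrite -enormN opprB. Qed.

Lemma enormZ (k : R) z : enorm (k * z.1, k * z.2) = `|k| * enorm z.
Proof.
rewrite /enorm /= !exprMn -mulrDr sqrtrM ?sqr_ge0// sqrtr_sqr//.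
Qed.

Lemma enorm_abs1 z : `|z.1| <= enorm z.
Proof.
rewrite -(@ler_pXn2r _ 2%N)// ?nnegrE ?enorm_ge0// enorm_sqr real_normK ?num_real//.
by rewrite lerDl sqr_ge0.
Qed.

Lemma enorm_abs2 z : `|z.2| <= enorm z.
Proof.
rewrite -(@ler_pXn2r _ 2%N)// ?nnegrE ?enorm_ge0// enorm_sqr real_normK ?num_real//.
by rewrite lerDr sqr_ge0.
Qed.

Lemma enorm_le_abs z : enorm z <= `|z.1| + `|z.2|.
Proof.
apply: enorm_le; first by rewrite addr_ge0.
rewrite -(real_normK (num_real z.1)) -(real_normK (num_real z.2)).
by have := normr_ge0 z.1; have := normr_ge0 z.2; nra.
Qed.

Definition lerp z w (l : R) : R * R :=
  (z.1 + l * (w.1 - z.1), z.2 + l * (w.2 - z.2)).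

Definition seg z w : set (R * R) :=
  [set v | exists2 l : R, 0 <= l <= 1 & v = lerp z w l].

(** Squaring the hypothesis reverses the Cauchy-Schwarz inequality for [v - z] and [w - v]. Hence
    [b (v - z) - a (w - v)] has nonpositive squared norm and vanishes, which puts [v] at parameter
    [a / (a + b)]. *)
Lemma enorm_triangle_eq z w v :
  enorm (v - z) + enorm (w - v) <= enorm (w - z) -> seg z w v.
Proof.
move=> h.
set a := enorm (v - z) in h *; set b := enorm (w - v) in h *.
have a0 : 0 <= a by exact: enorm_ge0.
have b0 : 0 <= b by exact: enorm_ge0.
have [/eqP ab0|ab0] := boolP (a + b == 0).
  have /enorm_eq0 vz : a = 0 by lra.
  have /enorm_eq0 wv : b = 0 by lra.
  exists 0; rewrite ?lexx ?ler01// /lerp !mul0r !addr0 -surjective_pairing.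
  by apply/eqP; rewrite -subr_eq0 vz.
have ab : 0 < a + b by rewrite lt_neqAle eq_sym ab0 addr_ge0.
have [x0 [y0]] : exists x y, v - z = (x, y) by exists (v - z).1, (v - z).2; case: (v - z).
move=> vzE; have [x1 [y1]] : exists x y, w - v = (x, y) by exists (w - v).1, (w - v).2; case: (w - v).
move=> wvE.
have wzE : w - z = (x0 + x1, y0 + y1).
  have -> : w - z = (v - z) + (w - v) by rewrite [RHS]addrC addrA subrK.
  by rewrite vzE wvE.
have ha : a ^+ 2 = x0 ^+ 2 + y0 ^+ 2 by rewrite enorm_sqr vzE.
have hb : b ^+ 2 = x1 ^+ 2 + y1 ^+ 2 by rewrite enorm_sqr wvE.
have hab : (a + b) ^+ 2 <= (x0 + x1) ^+ 2 + (y0 + y1) ^+ 2.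
  rewrite -[leRHS]/((x0 + x1, y0 + y1).1 ^+ 2 + (x0 + x1, y0 + y1).2 ^+ 2).
  by rewrite -wzE -enorm_sqr ler_pXn2r// nnegrE ?addr_ge0 ?enorm_ge0.
have dot : a * b <= x0 * x1 + y0 * y1 by nra.
have sq : (b * x0 - a * x1) ^+ 2 + (b * y0 - a * y1) ^+ 2 <= 0.
  have -> : (b * x0 - a * x1) ^+ 2 + (b * y0 - a * y1) ^+ 2 =
     b ^+ 2 * (x0 ^+ 2 + y0 ^+ 2) + a ^+ 2 * (x1 ^+ 2 + y1 ^+ 2)
       - 2 * (a * b) * (x0 * x1 + y0 * y1) by ring.
  rewrite -ha -hb.
  have : 0 <= a * b by exact: mulr_ge0.
  move: dot; set A := a * b; set B := x0 * x1 + _ => dot A0.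
  rewrite (_ : b ^+ 2 * a ^+ 2 = A ^+ 2); last by rewrite /A; ring.
  rewrite (_ : a ^+ 2 * b ^+ 2 = A ^+ 2); last by rewrite /A; ring.
  nra.
have /eqP : (b * x0 - a * x1) ^+ 2 + (b * y0 - a * y1) ^+ 2 = 0.
  by apply/eqP; rewrite eq_le sq addr_ge0// sqr_ge0.
rewrite paddr_eq0 ?sqr_ge0// !sqrf_eq0 !subr_eq0 => /andP[/eqP ex /eqP ey].
have zvx : v.1 = z.1 + x0 by have := congr1 fst vzE => /= <-; ring.
have zvy : v.2 = z.2 + y0 by have := congr1 snd vzE => /= <-; ring.
have zwx : w.1 - z.1 = x0 + x1 by have := congr1 fst wzE.
have zwy : w.2 - z.2 = y0 + y1 by have := congr1 snd wzE.
exists (a / (a + b)).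
  by rewrite divr_ge0 ?(ltW ab)//= ler_pdivrMr// mul1r lerDl.
rewrite /lerp zwx zwy [LHS]surjective_pairing zvx zvy; congr (_ + _, _ + _).
- rewrite (_ : _ * _ = (a * x0 + a * x1) / (a + b)); last by ring.
  by rewrite -ex; field; lra.
- rewrite (_ : _ * _ = (a * y0 + a * y1) / (a + b)); last by ring.
  by rewrite -ey; field; lra.
Qed.

End EuclideanNorm.

(** * Length of piecewise C2 curves *)

Section CurveLength.
Variable R : realType.
Implicit Types (g gamma : R -> R * R) (a b c : R).
Notation mu := (@lebesgue_measure R).
Local Open Scope ereal_scope.

Lemma derivable1_continuous (f : R -> R) : (forall t, derivable f t 1%R) -> continuous f.
Proof. by move=> df t; apply/differentiable_continuous/derivable1_diffP. Qed.

Lemma speed_enorm g t :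
  speed g t = enorm (derive1 (fun u => (g u).1) t, derive1 (fun u => (g u).2) t).
Proof. by []. Qed.

Lemma speed_ge0 g t : (0 <= speed g t)%R.
Proof. exact: sqrtr_ge0. Qed.

Lemma C2_speed_continuous g : C2_fun g -> continuous (speed g).
Proof.
move=> [[_ /derivable1_continuous c1 _] [_ /derivable1_continuous c2 _]] t.
apply: continuous_comp; last exact: sqrt_continuous.
by apply: cvgD; apply: cvgM; [exact: c1|exact: c1|exact: c2|exact: c2].
Qed.

(** Only interior times are allowed: at [a] and [c] the derivative of [gamma] also depends on values
    outside the interval. *)
Lemma eq_speed gamma g a c t :
  (forall u, (a <= u <= c)%R -> gamma u = g u) -> (a < t < c)%R ->
  speed gamma t = speed g t.
Proof.
move=> h tac; have n : \near t, gamma t = g t.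
  have : t \in `]a, c[ by rewrite in_itv.
  move/near_in_itvoo; apply: filterS => u; rewrite in_itv/= => /andP[au uc].
  by apply: h; rewrite (ltW au) (ltW uc).
rewrite /speed !derive1E; congr (Num.sqrt (_ ^+ 2 + _ ^+ 2)).
- by apply: near_eq_derive; apply: filterS n => u ->.
- by apply: near_eq_derive; apply: filterS n => u ->.
Qed.

(** Project the curve onto the unit vector [(e1, e2)] along its chord. The derivative of the
    projection integrates to the chord length [D], and by Cauchy-Schwarz it is at most the speed. *)
Lemma C2_enorm_le_length g a c : (a < c)%R -> C2_fun g ->
  (enorm (g c - g a))%:E <= \int[mu]_(t in `[a, c]) (speed g t)%:E.
Proof.
move=> ac Cg; have cs := C2_speed_continuous Cg.
set D := enorm _.
have [D0|Dn0] := eqVneq D 0%R.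
  by rewrite D0; apply: integral_ge0 => t _; rewrite lee_fin speed_ge0.
have D0 : (0 < D)%R by rewrite lt_neqAle eq_sym Dn0 enorm_ge0.
pose e1 := ((g c - g a).1 / D)%R; pose e2 := ((g c - g a).2 / D)%R.
have e12 : enorm (e1, e2) = 1%R.
  have -> : (e1, e2) = (D^-1 * (g c - g a).1, D^-1 * (g c - g a).2)%R.
    by rewrite /e1 /e2 ![(_ / D)%R]mulrC.
  by rewrite enormZ gtr0_norm ?invr_gt0// mulVf.
case: Cg => -[d1 /derivable1_continuous c1 _] [d2 /derivable1_continuous c2 _].
pose h := (e1 \*: (fun t => (g t).1) + e2 \*: (fun t => (g t).2))%R.
have dh t : is_derive t (1%R : R) h
    (e1 * derive1 (fun t => (g t).1) t + e2 * derive1 (fun t => (g t).2) t)%R.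
  apply: is_deriveD; apply: is_deriveZ; rewrite derive1E; apply/derivableP.
  - exact: d1.
  - exact: d2.
have ch : continuous h by apply: derivable1_continuous => t; have [] := dh t.
set h' := (fun t => e1 * derive1 (fun t => (g t).1) t +
   e2 * derive1 (fun t => (g t).2) t)%R.
have ch' : continuous h'.
  by move=> t; apply: cvgD; apply: cvgMr; [exact: c1|exact: c2].
have FTC : \int[mu]_(t in `[a, c]) (h' t)%:E = D%:E.
  rewrite (@continuous_FTC2 _ h' h)//.
  - have hE t : h t = (e1 * (g t).1 + e2 * (g t).2)%R by [].
    rewrite -EFinB !hE; congr EFin.
    rewrite [LHS](_ : _ = ((g c - g a).1 ^+ 2 + (g c - g a).2 ^+ 2) / D)%R.
      by rewrite -enorm_sqr expr2 mulfK.
    rewrite /e1 /e2 /=; ring.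
  - exact: continuous_subspaceT.
  - split; first by move=> t _; have [] := dh t.
    + by apply: cvg_at_right_filter; exact: ch.
    + by apply: cvg_at_left_filter; exact: ch.
  - by move=> t _; rewrite derive1E; apply: derive_val.
rewrite -FTC; apply: le_integral => //.
- apply: continuous_compact_integrable; first exact: segment_compact.
  exact: continuous_subspaceT.
- apply: continuous_compact_integrable; first exact: segment_compact.
  exact: continuous_subspaceT.
- move=> t _; rewrite lee_fin speed_enorm.
  by have := dot_le_enorm (e1, e2) (derive1 (fun u => (g u).1) t, derive1 (fun u => (g u).2) t); rewrite e12 mul1r.
Qed.

Lemma piece_measurable gamma g a c : (a < c)%R -> C2_fun g ->
  (forall u, (a <= u <= c)%R -> gamma u = g u) ->
  measurable_fun `]a, c[ (speed gamma).
Proof.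
move=> ac Cg E.
apply: (eq_measurable_fun (speed g)).
  move=> t; rewrite inE/= in_itv/= => tac.
  by rewrite (eq_speed E).
apply: open_continuous_measurable_fun => // t _; exact: C2_speed_continuous.
Qed.

Lemma length_piece gamma g a c : (a < c)%R -> C2_fun g ->
  (forall u, (a <= u <= c)%R -> gamma u = g u) ->
  curve_length gamma a c = \int[mu]_(t in `[a, c]) (speed g t)%:E.
Proof.
move=> ac Cg E; apply: eq_integral_itv_bounded.
- exact: (piece_measurable ac Cg E).
- exact: (piece_measurable ac Cg).
- by move=> t; rewrite in_itv/= => tac; rewrite (eq_speed E).
Qed.

(** List-like form of [piecewise_C2], which allows induction on the pieces when curves are cut,
    glued or measured. *)
Inductive pwC2 gamma : R -> R -> Prop :=
| pwC2_refl a : pwC2 gamma a a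
| pwC2_step a c b : (a < c)%R ->
    (exists g, C2_fun g /\ forall u, (a <= u <= c)%R -> gamma u = g u) ->
    pwC2 gamma c b -> pwC2 gamma a b.

Lemma piecewise_C2P gamma a b : piecewise_C2 gamma a b <-> pwC2 gamma a b.
Proof.
split=> [[n [s [<- <- lts H]]]|].
  elim: n s lts H => [|n IH] s lts H; first exact: pwC2_refl.
  apply: (@pwC2_step _ _ (s 1%N)); [exact: lts|exact: H|].
  by apply: (IH (s \o S)) => i ltin; [exact: lts|exact: H].
elim=> {a b} [a|a c b ac H _ [n [s [s0 sn lts Hs]]]].
  by exists 0%N, (fun=> a).
exists n.+1, (fun i => if i is j.+1 then s j else a); split => //.
- by case=> [_|i /lts//]; rewrite s0.
- by case=> [_|i /Hs//]; rewrite s0.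
Qed.

Lemma pwC2_le gamma a b : pwC2 gamma a b -> (a <= b)%R.
Proof. by elim=> {a b} [a|a c b ac _ _ cb] //; apply: le_trans cb; exact: ltW. Qed.

Lemma pwC2_trans gamma a b c : pwC2 gamma a b -> pwC2 gamma b c -> pwC2 gamma a c.
Proof.
move=> ab; elim: ab c => {a b}[a c//|a d b ad H _ IH c bc].
by apply: pwC2_step ad H _; exact: IH.
Qed.

Lemma pwC2_split gamma a b c : pwC2 gamma a b -> (a <= c <= b)%R ->
  pwC2 gamma a c /\ pwC2 gamma c b.
Proof.
move=> ab; elim: ab c => {a b}[a c|a d b ad [g [Cg H]] db IH c /andP[ac cb]].
  by move/le_anti => ->; split; exact: pwC2_refl.
have [cd|dc] := ltP c d; last first.
  have [|dc' cb'] := IH c; first by rewrite dc.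
  by split => //; apply: pwC2_step dc' => //; exists g.
split; last first.
  apply: pwC2_step db => //; exists g; split=> // u /andP[cu ud].
  by apply: H; rewrite ud (le_trans ac cu).
move: ac; rewrite le_eqVlt => /predU1P[->|ac]; first exact: pwC2_refl.
apply: pwC2_step ac _ (pwC2_refl _ _); exists g; split=> // u /andP[au uc].
by apply: H; rewrite au (le_trans uc (ltW cd)).
Qed.

Lemma pwC2_eq gamma delta a b : pwC2 gamma a b ->
  (forall u, (a <= u <= b)%R -> delta u = gamma u) -> pwC2 delta a b.
Proof.
elim=> {a b}[a _|a d b ad [g [Cg H]] db IH E]; first exact: pwC2_refl.
apply: (pwC2_step ad).
  exists g; split=> // u /andP[au ud]; rewrite E ?H ?au//.
  exact: le_trans ud (pwC2_le db).
by apply: IH => u /andP[du ub]; apply: E; rewrite ub (le_trans (ltW ad) du).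
Qed.

Lemma itvcc_split a b c : (a <= c <= b)%R ->
  `[a, b]%classic = `[a, c]%classic `|` `[c, b]%classic.
Proof.
move=> /andP[ac cb]; apply/seteqP; split=> u /=; rewrite !in_itv/=.
  by move=> /andP[-> ->]; have [uc|/ltW cu] := leP u c; [left|right]; rewrite ?cu.
move=> [/andP[-> uc]|/andP[cu ->]].
  by rewrite (le_trans uc cb).
by rewrite (le_trans ac cu).
Qed.

Lemma pwC2_continuous gamma a b : pwC2 gamma a b ->
  {within `[a, b], continuous gamma}.
Proof.
elim=> {a b}[a|a c b ac [g [Cg H]] cb IH].
  rewrite set_itv1; exact: continuous_subspace1.
rewrite (@itvcc_split a b c) ?(ltW ac) ?(pwC2_le cb)//.
apply: withinU_continuous => //; try exact: interval_closed.
apply: (@subspace_eq_continuous _ _ _ g).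
  by move=> u; rewrite inE/= in_itv/= => /H.
apply: continuous_subspaceT => t.
case: Cg => -[/derivable1_continuous c1 _ _] [/derivable1_continuous c2 _ _].
rewrite (_ : g = fun t => ((g t).1, (g t).2)); last by apply/funext => u; case: (g u).
exact: (cvg_pair (c1 t) (c2 t)).
Qed.

Lemma pwC2_measurable gamma a b : pwC2 gamma a b ->
  measurable_fun `[a, b] (speed gamma).
Proof.
elim=> {a b}[a|a c b ac [g [Cg H]] cb IH].
  by rewrite set_itv1; exact: measurable_fun_set1.
rewrite (@itvcc_split a b c) ?(ltW ac) ?(pwC2_le cb)//.
apply/measurable_funU => //; split => //.
by apply: measurable_fun_itv_cc; exact: piece_measurable Cg H.
Qed.

Lemma pwC2_length_split gamma a b c : pwC2 gamma a b -> (a <= c <= b)%R ->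
  curve_length gamma a b = curve_length gamma a c + curve_length gamma c b.
Proof.
move=> ab /andP[ac cb]; have m := pwC2_measurable ab.
(* Dropping the null point [c] from the second interval makes the union disjoint. *)
rewrite /curve_length -(@integral_itv_obnd_cbnd _ c (BRight b)); last first.
  apply/measurable_EFinP; apply: measurable_funS m => // u/=.
  by rewrite !in_itv/= => /andP[cu ->]; rewrite (le_trans ac (ltW cu)).
rewrite (@itv_bndbnd_setU _ _ _ (BRight c)) ?bnd_simp//.
rewrite ge0_integral_setU//=.
- rewrite -itv_bndbnd_setU ?bnd_simp//; exact/measurable_EFinP.
- by move=> u _; rewrite lee_fin speed_ge0.
- apply/disj_setPS => u [/=]; rewrite !in_itv/= => /andP[_ uc] /andP[cu _].
  by move: (lt_le_trans cu uc); rewrite ltxx.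
Qed.

Lemma pwC2_eq_length gamma delta a b : pwC2 gamma a b ->
  (forall u, (a <= u <= b)%R -> delta u = gamma u) ->
  curve_length delta a b = curve_length gamma a b.
Proof.
move=> pg E; have pd := pwC2_eq pg E.
apply: eq_integral_itv_bounded.
- by apply: measurable_funS (pwC2_measurable pd) => //; exact: subset_itv_oo_cc.
- by apply: measurable_funS (pwC2_measurable pg) => //; exact: subset_itv_oo_cc.
- by move=> t; rewrite in_itv/= => tac; rewrite (eq_speed E).
Qed.

Lemma length_ge0 gamma a b : 0 <= curve_length gamma a b.
Proof. by apply: integral_ge0 => t _; rewrite lee_fin speed_ge0. Qed.

Lemma pwC2_enorm_le_length gamma a b : pwC2 gamma a b ->
  (enorm (gamma b - gamma a))%:E <= curve_length gamma a b.
Proof.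
elim=> {a b}[a|a c b ac [g [Cg H]] cb IH].
  by rewrite subrr /enorm /= expr0n/= addr0 sqrtr0 length_ge0.
have ab : pwC2 gamma a b by apply: pwC2_step (cb) => //; exists g.
rewrite (pwC2_length_split (c := c) ab) ?(ltW ac) ?(pwC2_le cb)//.
apply: (@le_trans _ _ ((enorm (gamma c - gamma a))%:E + (enorm (gamma b - gamma c))%:E)).
  rewrite -EFinD lee_fin; apply: le_trans (ler_enormD _ _).
  by rewrite [X in (_ <= enorm X)%R]addrC addrA subrK.
apply: leeD; last exact: IH.
rewrite (length_piece ac Cg H).
have -> : gamma a = g a by apply: H; rewrite lexx ltW.
have -> : gamma c = g c by apply: H; rewrite lexx ltW.
exact: C2_enorm_le_length.
Qed.

(** Finiteness is what allows lengths to be cancelled in extended-real inequalities. *)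
Lemma pwC2_length_fin gamma a b : pwC2 gamma a b ->
  curve_length gamma a b \is a fin_num.
Proof.
elim=> {a b}[a|a c b ac [g [Cg H]] cb IH].
  by rewrite /curve_length set_itv1 integral_set1.
have ab : pwC2 gamma a b by apply: pwC2_step (cb) => //; exists g.
rewrite (pwC2_length_split (c := c) ab) ?(ltW ac) ?(pwC2_le cb)//.
rewrite fin_numD IH andbT (length_piece ac Cg H).
apply: integrable_fin_num => //.
apply: continuous_compact_integrable; first exact: segment_compact.
by apply: continuous_subspaceT; exact: C2_speed_continuous.
Qed.

Lemma C2_length_le g a c (K : R) : (a < c)%R -> C2_fun g ->
  (forall t, (a <= t <= c)%R -> (speed g t <= K)%R) ->
  curve_length g a c <= (K * (c - a))%:E.
Proof.
move=> ac Cg H.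
apply: (@le_trans _ _ (\int[mu]_(t in `[a, c]) (cst K%:E t))).
  apply: ge0_le_integral => //.
  - by move=> t _; rewrite lee_fin speed_ge0.
  - apply/measurable_EFinP; apply: measurable_funS (continuous_measurable_fun _) => //.
    exact: C2_speed_continuous.
rewrite (integral_cst mu (measurable_itv `[a, c]) K%:E).
by rewrite /= lebesgue_measure_itv/= lte_fin ac -EFinB -EFinM.
Qed.

End CurveLength.

(** * Shortest curves *)

Section ShortestCurves.
Variables (R : realType) (X : set (R * R)) (A B : R * R) (gamma : R -> R * R) (a b : R).
Hypothesis gamma_shortest : shortest_curve X A B gamma a b.

Lemma shortest_in u : a <= u <= b -> X (gamma u).
Proof. by have [[[_ _ _ h] _] _] := gamma_shortest; exact: h. Qed.

Lemma shortest_continuous : {within `[a, b], continuous gamma}.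
Proof. by have [[[]]] := gamma_shortest. Qed.

(** Splicing [delta] into [gamma] on [[s, t]] gives an admissible competitor [rho]; the lengths over
    [[a, s]] and [[t, b]] are unchanged and cancel. *)
Lemma shortest_sub_le (delta : R -> R * R) s t : a <= s -> s < t -> t <= b ->
  C2_fun delta -> delta s = gamma s -> delta t = gamma t ->
  (forall u, s <= u <= t -> X (delta u)) ->
  (curve_length gamma s t <= curve_length delta s t)%E.
Proof.
move=> ss st tb Cd ds dt dX.
have [[[ab cg /piecewise_C2P pg gX] [gA gB]] gmin] := gamma_shortest.
pose rho u := if s <= u <= t then delta u else gamma u.
have rho_s u : a <= u <= s -> rho u = gamma u.
  rewrite /rho => /andP[au us]; case: ifPn => // /andP[su _].
  by rewrite (_ : u = s)//; apply/eqP; rewrite eq_le us.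
have rho_t u : t <= u <= b -> rho u = gamma u.
  rewrite /rho => /andP[tu ub]; case: ifPn => // /andP[_ ut].
  by rewrite (_ : u = t)//; apply/eqP; rewrite eq_le ut.
have rho_m u : s <= u <= t -> rho u = delta u by rewrite /rho => ->.
have [pas psb] : pwC2 gamma a s /\ pwC2 gamma s b.
  by apply: pwC2_split => //; rewrite ss (le_trans (ltW st)).
have [pst ptb] : pwC2 gamma s t /\ pwC2 gamma t b.
  by apply: pwC2_split => //; rewrite (ltW st).
have ras := pwC2_eq pas rho_s; have rtb := pwC2_eq ptb rho_t.
have dst : pwC2 delta s t.
  by apply: pwC2_step st _ (pwC2_refl _ _); exists delta.
have rst := pwC2_eq dst rho_m.
have rsb := pwC2_trans rst rtb; have rab := pwC2_trans ras rsb.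
have adm : admissible_curve X A B rho a b.
  split; last by rewrite rho_s ?rho_t ?lexx// ?tb.
  split => //; [exact: pwC2_continuous|exact/piecewise_C2P|].
  move=> u uab; rewrite /rho; case: ifPn => [|_]; first exact: dX.
  exact: gX.
have sb := le_trans (ltW st) tb.
have asb : a <= s <= b by rewrite ss sb.
have stb : s <= t <= b by rewrite (ltW st) tb.
have := gmin _ _ _ adm.
rewrite (pwC2_length_split pg asb) (pwC2_length_split psb stb).
rewrite (pwC2_length_split rab asb) (pwC2_length_split rsb stb).
rewrite (pwC2_eq_length pas rho_s) (pwC2_eq_length ptb rho_t).
rewrite (pwC2_eq_length dst rho_m).
rewrite (leeD2lE _ _ (pwC2_length_fin pas)).
by rewrite (leeD2rE _ _ (pwC2_length_fin ptb)).
Qed.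

(** This is how minimality enters the geometry: a competitor of bounded speed confines [gamma u] to
    an ellipse with foci [gamma s] and [gamma t]. *)
Lemma shortest_detour (delta : R -> R * R) (K : R) s t u :
  a <= s -> s < t -> t <= b -> s <= u <= t ->
  C2_fun delta -> delta s = gamma s -> delta t = gamma t ->
  (forall u, s <= u <= t -> X (delta u)) ->
  (forall u, s <= u <= t -> speed delta u <= K) ->
  enorm (gamma u - gamma s) + enorm (gamma t - gamma u) <= K * (t - s).
Proof.
move=> ss st tb sut Cd ds dt dX dK.
have [[[ab cg /piecewise_C2P pg gX] [gA gB]] gmin] := gamma_shortest.
have [_ psb] : pwC2 gamma a s /\ pwC2 gamma s b.
  by apply: pwC2_split => //; rewrite ss (le_trans (ltW st)).
have [pst _] : pwC2 gamma s t /\ pwC2 gamma t b.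
  by apply: pwC2_split => //; rewrite (ltW st).
have [psu put] := pwC2_split pst sut.
rewrite -lee_fin EFinD.
apply: le_trans (leeD (pwC2_enorm_le_length psu) (pwC2_enorm_le_length put)) _.
rewrite -(pwC2_length_split pst sut).
exact: le_trans (shortest_sub_le ss st tb Cd ds dt dX) (C2_length_le st Cd dK).
Qed.

End ShortestCurves.

(** * Shortest curves along chords, and counting of components *)

Section Segments.
Variable R : realType.

Lemma derive1_horner (p : {poly R}) : derive1 (horner p) = horner (deriv p).
Proof. by apply/funext => t; rewrite derive1E; apply: derive_val. Qed.

Lemma C2_poly (p q : {poly R}) : C2_fun (fun t => (p.[t], q.[t])).
Proof.
have h (r : {poly R}) : [/\ (forall t, derivable (horner r) t 1),
    (forall t, derivable (derive1 (horner r)) t 1)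
    & continuous (derive1 (derive1 (horner r)))].
  by rewrite !derive1_horner; split; [move=> t|move=> t|exact: continuous_horner];
     exact: derivable_horner.
by split; exact: h.
Qed.

Lemma speed_poly (p q : {poly R}) t :
  speed (fun t => (p.[t], q.[t])) t = enorm ((deriv p).[t], (deriv q).[t]).
Proof.
rewrite speed_enorm -[fun u => _.1]/(horner p) -[fun u => _.2]/(horner q).
by rewrite !derive1_horner.
Qed.

Lemma seg_left (z w : R * R) : seg z w z.
Proof.
by exists 0; rewrite ?lexx ?ler01// /lerp !mul0r !addr0 -surjective_pairing.
Qed.

Lemma seg_id (z w : R * R) : seg z z w -> w = z.
Proof. by move=> [l _ ->]; rewrite /lerp !subrr !mulr0 !addr0 -surjective_pairing. Qed.

(** The chord, run at constant speed, is a competitor of length equal to the distance of its ends,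
    so [shortest_detour] yields the equality case of the triangle inequality. *)
Lemma shortest_seg (X : set (R * R)) A B gamma (a b s t u : R) :
  shortest_curve X A B gamma a b ->
  a <= s -> t <= b -> s <= u <= t -> seg (gamma s) (gamma t) `<=` X ->
  seg (gamma s) (gamma t) (gamma u).
Proof.
move=> gs ss tb /[dup] sut /andP[su ut] sX.
have [st|ts] := ltP s t; last first.
  rewrite (_ : u = s); first exact: seg_left.
  by apply/eqP; rewrite eq_le su (le_trans ut).
have ts0 : 0 < t - s by rewrite subr_gt0.
have tsn0 : t - s != 0 by lra.
pose d := gamma t - gamma s.
pose pol (c k : R) : {poly R} := (c%:P + (k / (t - s))%:P * ('X - s%:P)).
have polE c k v : (pol c k).[v] = c + k / (t - s) * (v - s).
  by rewrite /pol !hornerE.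
have dpol c k v : (deriv (pol c k)).[v] = k / (t - s).
  rewrite /pol derivD derivC add0r derivM derivC mul0r add0r derivB derivX derivC.
  by rewrite subr0 mulr1 hornerC.
pose delta v := ((pol (gamma s).1 d.1).[v], (pol (gamma s).2 d.2).[v]).
have deltaE v : delta v = lerp (gamma s) (gamma t) ((v - s) / (t - s)).
  by rewrite /delta /lerp !polE; congr pair; rewrite /d/=; ring.
apply: enorm_triangle_eq.
have -> : enorm (gamma t - gamma s) = enorm (gamma t - gamma s) / (t - s) * (t - s).
  by rewrite divfK.
apply: (shortest_detour gs (delta := delta)) => //.
- exact: C2_poly.
- by rewrite deltaE subrr mul0r /lerp !mul0r !addr0 -surjective_pairing.
- rewrite deltaE divff// /lerp !mul1r.
  by rewrite [X in (_ + X, _)]addrC [X in (_, _ + X)]addrC !addrA !subrr !add0r -surjective_pairing.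
- move=> v /andP[sv vt]; apply: sX; exists ((v - s) / (t - s)) => //.
  by rewrite divr_ge0 ?subr_ge0 ?(ltW st)//= ler_pdivrMr// mul1r lerD2r.
- move=> v _; rewrite speed_poly !dpol.
  rewrite (_ : (_, _) = ((t - s)^-1 * d.1, (t - s)^-1 * d.2)); last by congr pair; rewrite mulrC.
  by rewrite enormZ gtr0_norm ?invr_gt0// mulrC.
Qed.

(** The chord degenerates to a point of [X]. In particular a shortest curve never returns to a point
    that it has left. *)
Lemma shortest_const (X : set (R * R)) A B gamma (a b s t u : R) :
  shortest_curve X A B gamma a b ->
  a <= s -> t <= b -> s <= u <= t -> gamma s = gamma t -> gamma u = gamma s.
Proof.
move=> gs ss tb sut gst; apply: seg_id.
rewrite {2}gst; apply: (shortest_seg gs) => //.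
move=> v; rewrite -gst => /seg_id ->; apply: (shortest_in gs).
by case/andP: sut => su ut; rewrite ss (le_trans su)// (le_trans ut).
Qed.

(** Each connected subset of [S] lies in a single component, so there are at most two components. *)
Lemma finite_components2 (S S1 S2 : set R) : S = S1 `|` S2 ->
  connected S1 -> connected S2 -> finite_set (connected_component S @` S).
Proof.
move=> SE c1 c2.
have fin S0 : connected S0 -> S0 `<=` S ->
    finite_set (connected_component S @` S0).
  move=> c0 S0S; have [[x S0x]|noS0] := pselect (exists x, S0 x).
    apply: (@sub_finite_set _ _ [set connected_component S x]) => //.
    move=> _ [y S0y <-] /=; apply: same_connected_component.
    exact: (connected_component_max S0y S0S c0).
  by apply: (@sub_finite_set _ _ set0) => // C [y S0y _]; apply: noS0; exists y.
have -> : connected_component S @` S =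
    connected_component S @` S1 `|` connected_component S @` S2.
  by rewrite -image_setU -SE.
rewrite finite_setU.
by split; apply: fin => //; rewrite SE => x ?; [left|right].
Qed.

Lemma interval_interacts (gamma : R -> R * R) (a b : R) e :
  (forall s t u, a <= s -> t <= b -> s <= u <= t -> e (gamma s) -> e (gamma t) ->
     e (gamma u)) -> interacts_finitely gamma a b e.
Proof.
move=> h; rewrite /interacts_finitely.
set S := [set t | _].
have cS : connected S.
  apply/connected_intervalP => s t [/andP[ss sb] es] [/andP[ta tb] et] u sut; split.
    by case/andP: sut => su ut; rewrite (le_trans ss su) (le_trans ut tb).
  exact: (h s t).
by apply: (@finite_components2 _ S S); rewrite ?setUid.
Qed.

Lemma convex_interacts (X : set (R * R)) A B gamma (a b : R) e :
  shortest_curve X A B gamma a b -> e `<=` X ->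
  (forall z w, e z -> e w -> seg z w `<=` e) -> interacts_finitely gamma a b e.
Proof.
move=> gs eX econv; apply: interval_interacts => s t u ss tb sut es et.
apply: (econv _ _ es et); apply: (shortest_seg gs) => //.
exact: subset_trans (econv _ _ es et) eX.
Qed.

Lemma set1_interacts (X : set (R * R)) A B gamma (a b : R) z : X z ->
  shortest_curve X A B gamma a b -> interacts_finitely gamma a b [set z].
Proof.
move=> Xz gs; apply: (convex_interacts gs); first by move=> _ ->.
by move=> _ _ -> -> w /seg_id.
Qed.

(** By [shortest_const] the times spent at a given point form an interval. *)
Lemma two_points_interacts (X : set (R * R)) A B gamma (a b : R) e z1 z2 :
  shortest_curve X A B gamma a b ->
  (forall u, a <= u <= b -> e (gamma u) -> gamma u = z1 \/ gamma u = z2) ->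
  interacts_finitely gamma a b e.
Proof.
move=> gs h; rewrite /interacts_finitely; set S := [set t | _].
pose T z := [set t | S t /\ gamma t = z].
have cT z : connected (T z).
  apply/connected_intervalP => s t [[/andP[ss sb] es] sz] [[/andP[ta tb] et] tz] u sut.
  have uz : gamma u = z.
    by rewrite -sz; apply: (shortest_const gs ss tb sut); rewrite sz.
  split=> //; split; last by rewrite uz -sz.
  by case/andP: sut => su ut; rewrite (le_trans ss su) (le_trans ut tb).
apply: (@finite_components2 _ (T z1) (T z2)) => //.
apply/seteqP; split=> [u [uab eu]|u]; last by case=> -[].
by have [uz|uz] := h u uab eu; [left|right]; split.
Qed.

End Segments.

(** * Boundary curves *)

Section PolynomialCurve.
Variables (R : realType) (p : {poly R}) (th : R).
Implicit Types (z w : R * R) (t x y l : R).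

(* The coordinates in which Phi p th = 0 is the graph of p, and Gam p th parametrises
   that graph. *)
Definition rotX z : R := z.1 * cos th + z.2 * sin th.
Definition rotY z : R := - z.1 * sin th + z.2 * cos th.
Definition Gam t : R * R := (t * cos th - p.[t] * sin th, t * sin th + p.[t] * cos th).

Lemma PhiE z : Phi p th z = p.[rotX z] - rotY z.
Proof. by []. Qed.

Lemma rotK z : z = (rotX z * cos th - rotY z * sin th, rotX z * sin th + rotY z * cos th).
Proof.
case: z => x y; rewrite /rotX /rotY /=; congr pair.
- have -> : (x * cos th + y * sin th) * cos th - (- x * sin th + y * cos th) * sin th =
    x * (cos th ^+ 2 + sin th ^+ 2) by ring.
  by rewrite cos2Dsin2 mulr1.
- have -> : (x * cos th + y * sin th) * sin th + (- x * sin th + y * cos th) * cos th =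
    y * (cos th ^+ 2 + sin th ^+ 2) by ring.
  by rewrite cos2Dsin2 mulr1.
Qed.

Lemma rotX_rot x y : rotX (x * cos th - y * sin th, x * sin th + y * cos th) = x.
Proof.
rewrite /rotX /= [LHS](_ : _ = x * (cos th ^+ 2 + sin th ^+ 2)); last by ring.
by rewrite cos2Dsin2 mulr1.
Qed.

Lemma rotY_rot x y : rotY (x * cos th - y * sin th, x * sin th + y * cos th) = y.
Proof.
rewrite /rotY /= [LHS](_ : _ = y * (cos th ^+ 2 + sin th ^+ 2)); last by ring.
by rewrite cos2Dsin2 mulr1.
Qed.

Lemma rotX_Gam t : rotX (Gam t) = t. Proof. exact: rotX_rot. Qed.

Lemma rotY_Gam t : rotY (Gam t) = p.[t]. Proof. exact: rotY_rot. Qed.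

Lemma Phi_Gam t : Phi p th (Gam t) = 0.
Proof. by rewrite PhiE rotX_Gam rotY_Gam subrr. Qed.

Lemma Gam_rotX z : Phi p th z = 0 -> Gam (rotX z) = z.
Proof.
by move=> /eqP; rewrite PhiE subr_eq0 => /eqP h; rewrite {2}(rotK z) /Gam h.
Qed.

Lemma rotX_lerp z w l : rotX (lerp z w l) = rotX z + l * (rotX w - rotX z).
Proof. rewrite /rotX /lerp/=; ring. Qed.

Lemma rotY_lerp z w l : rotY (lerp z w l) = rotY z + l * (rotY w - rotY z).
Proof. rewrite /rotY /lerp/=; ring. Qed.

Lemma rotX_lip z w : `|rotX z - rotX w| <= enorm (z - w).
Proof.
have e1 : enorm (cos th, sin th) = 1 by rewrite /enorm/= cos2Dsin2 sqrtr1.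
rewrite ler_norml; apply/andP; split.
- rewrite lerNl -[leRHS]mulr1 -e1 enormB; apply: le_trans (dot_le_enorm _ _).
  by rewrite /rotX/=; lra.
- rewrite -[leRHS]mulr1 -e1; apply: le_trans (dot_le_enorm _ _).
  by rewrite /rotX/=; lra.
Qed.

Lemma rotX_continuous : continuous rotX.
Proof.
by move=> z; apply: cvgD; apply: cvgMl; [exact: cvg_fst|exact: cvg_snd].
Qed.

Lemma rotY_continuous : continuous rotY.
Proof.
by move=> z; apply: cvgD; apply: cvgMl; [apply: cvgN; exact: cvg_fst|exact: cvg_snd].
Qed.

Lemma Phi_continuous : continuous (Phi p th).
Proof.
move=> z; apply: cvgB; last exact: rotY_continuous.
by apply: (@continuous_comp _ _ _ rotX (horner p) z); [exact: rotX_continuous|exact: continuous_horner].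
Qed.

Definition Gam1 : {poly R} := (cos th) *: 'X - (sin th) *: p.
Definition Gam2 : {poly R} := (sin th) *: 'X + (cos th) *: p.

Lemma GamE t : Gam t = (Gam1.[t], Gam2.[t]).
Proof. by rewrite /Gam /Gam1 /Gam2 !hornerE; congr (_ + _, _ + _); rewrite mulrC. Qed.

End PolynomialCurve.

(** * Strict convexity of polynomials and the behaviour of [Phi] on chords *)

Section ConvexPolynomials.
Variable R : realType.
Implicit Types (p : {poly R}).

(** The mean value theorem on [[x, z]] and [[z, y]] turns the chord slopes into values of [p'] at
    [c1 < c2]; applied once more, to [p'], it compares them. *)
Lemma poly_strict_convex_lt p (x y l : R) : x < y -> 0 < l < 1 ->
  (forall v, x <= v <= y -> 0 < (deriv (deriv p)).[v]) ->
  p.[x + l * (y - x)] < p.[x] + l * (p.[y] - p.[x]).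
Proof.
move=> xy /andP[l0 l1] p2; set z := x + l * (y - x).
have xz : x < z by rewrite /z; nra.
have zy : z < y by rewrite /z; nra.
have [c1] := poly_mvt p xz; rewrite in_itv/= => /andP[xc1 c1z] h1.
have [c2] := poly_mvt p zy; rewrite in_itv/= => /andP[zc2 c2y] h2.
have c12 : c1 < c2 by lra.
have [c3] := poly_mvt (deriv p) c12; rewrite in_itv/= => /andP[c13 c32] h3.
have : 0 < (deriv (deriv p)).[c3] * (c2 - c1).
  by rewrite mulr_gt0 ?subr_gt0// p2//; apply/andP; split; lra.
rewrite -h3 => h.
have zx : z - x = l * (y - x) by rewrite /z; ring.
have yz : y - z = (1 - l) * (y - x) by rewrite /z; ring.
rewrite zx in h1; rewrite yz in h2.
have : 0 < ((deriv p).[c2] - (deriv p).[c1]) * (l * (1 - l) * (y - x)).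
  by rewrite mulr_gt0// !mulr_gt0// ?subr_gt0.
have -> : ((deriv p).[c2] - (deriv p).[c1]) * (l * (1 - l) * (y - x)) =
  l * ((deriv p).[c2] * ((1 - l) * (y - x))) - (1 - l) * ((deriv p).[c1] * (l * (y - x))) by ring.
rewrite -h1 -h2; lra.
Qed.

Lemma poly_strict_convex p (t0 r x y l : R) : x != y -> 0 < l < 1 ->
  (forall v, `|v - t0| < r -> 0 < (deriv (deriv p)).[v]) ->
  `|x - t0| < r -> `|y - t0| < r ->
  p.[x + l * (y - x)] < p.[x] + l * (p.[y] - p.[x]).
Proof.
move=> xy /andP[l0 l1] p2; rewrite !ltr_norml => /andP[xr xr'] /andP[yr yr'].
have [xlty|ylex] := ltP x y.
  apply: poly_strict_convex_lt => //; first by rewrite l0.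
  by move=> v /andP[xv vy]; apply: p2; rewrite ltr_norml; apply/andP; split; lra.
have yltx : y < x by rewrite lt_neqAle eq_sym xy.
(* When [y < x], the roles of the ends are exchanged and [l] becomes [1 - l]. *)
have h : p.[y + (1 - l) * (x - y)] < p.[y] + (1 - l) * (p.[x] - p.[y]).
  apply: poly_strict_convex_lt => //; first by apply/andP; split; lra.
  by move=> v /andP[yv vx]; apply: p2; rewrite ltr_norml; apply/andP; split; lra.
rewrite (_ : x + l * (y - x) = y + (1 - l) * (x - y)); last by ring.
by apply: lt_le_trans h _; lra.
Qed.

(** If the rotated abscissas differ, [Phi] is strictly convex along the chord. If they agree, [Phi]
    is affine there with nonzero slope, and so only strict quasiconvexity can be claimed. *)
Lemma Phi_lerp_lt_max p th (t0 r l : R) z w : z <> w -> 0 < l < 1 ->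
  (forall v, `|v - t0| < r -> 0 < (deriv (deriv p)).[v]) ->
  `|rotX th z - t0| < r -> `|rotX th w - t0| < r ->
  Phi p th (lerp z w l) < Num.max (Phi p th z) (Phi p th w).
Proof.
move=> zw l01 p2 zr wr; rewrite !PhiE rotX_lerp rotY_lerp.
set M := Num.max _ _.
have zM : p.[rotX th z] - rotY th z <= M by rewrite le_max lexx.
have wM : p.[rotX th w] - rotY th w <= M by rewrite le_max lexx orbT.
case/andP: (l01) => l0 l1.
have [xzw|xzw] := eqVneq (rotX th z) (rotX th w); last first.
  have := poly_strict_convex xzw l01 p2 zr wr; nra.
rewrite xzw subrr mulr0 addr0.
have ezw : rotY th z != rotY th w.
  by apply/eqP => ezw; apply: zw; rewrite (rotK th z) (rotK th w) xzw ezw.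
rewrite xzw in zM; move: ezw; rewrite neq_lt => /orP[h|h]; nra.
Qed.

Lemma Phi_chord_gt0 p th (t0 r l x y : R) : x != y -> 0 < l < 1 ->
  (forall v, `|v - t0| < r -> (deriv (deriv p)).[v] < 0) ->
  `|x - t0| < r -> `|y - t0| < r ->
  0 < Phi p th (lerp (Gam p th x) (Gam p th y) l).
Proof.
move=> xy l01 p2 xr yr; rewrite PhiE rotX_lerp rotY_lerp !rotX_Gam !rotY_Gam.
have := @poly_strict_convex (- p) t0 r x y l xy l01 _ xr yr.
rewrite !hornerN => h; have : - p.[x + l * (y - x)] < - p.[x] + l * (- p.[y] - - p.[x]).
  by apply: h => v /p2; rewrite !derivN hornerN oppr_gt0.
by move=> {h}h; lra.
Qed.

End ConvexPolynomials.

(** * Shortest curves near a boundary arc *)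

Section EuclideanTopology.
Variable R : realType.
Implicit Types (z w c : R * R).

Lemma nbhs_enorm z (N : set (R * R)) : nbhs z N ->
  exists2 e : R, 0 < e & forall w, enorm (w - z) < e -> N w.
Proof.
move=> /nbhs_ballP[e e0 h]; exists e => // w hw; apply: h.
split; rewrite /ball/= distrC.
- exact: le_lt_trans (enorm_abs1 (w - z)) hw.
- exact: le_lt_trans (enorm_abs2 (w - z)) hw.
Qed.

Lemma enorm_continuous : continuous (@enorm R).
Proof.
move=> z; apply: (@continuous_comp _ _ _ (fun z => z.1 ^+ 2 + z.2 ^+ 2) Num.sqrt);
  last exact: sqrt_continuous.
by apply: cvgD; apply: cvgM; [exact: cvg_fst|exact: cvg_fst|exact: cvg_snd|exact: cvg_snd].
Qed.

Lemma enormB_continuous c : continuous (fun z => enorm (z - c)).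
Proof.
move=> z; apply: (@continuous_comp _ _ _ (fun z => z - c) (@enorm R)).
  by apply: cvgB; [exact: cvg_id|exact: cvg_cst].
exact: enorm_continuous.
Qed.

Lemma lerp_ball z w c (r l : R) : enorm (z - c) < r -> enorm (w - c) < r ->
  0 <= l <= 1 -> enorm (lerp z w l - c) < r.
Proof.
move=> zr wr /andP[l0 l1].
have -> : lerp z w l - c = ((1 - l) * (z - c).1, (1 - l) * (z - c).2) +
    (l * (w - c).1, l * (w - c).2).
  rewrite /lerp [LHS]surjective_pairing [RHS]surjective_pairing /=.
  by congr pair; ring.
apply: le_lt_trans (ler_enormD _ _) _.
rewrite !enormZ ger0_norm ?subr_ge0// ger0_norm//.
have [-> //|l0'] := eqVneq l 0; first by rewrite subr0 mul1r mul0r addr0.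
have : 0 < l by rewrite lt_neqAle eq_sym l0'.
move: (enorm _) (enorm _) zr wr => x y xr yr lp; nra.
Qed.

Lemma lerp0 z w : lerp z w 0 = z.
Proof. by rewrite /lerp !mul0r !addr0 -surjective_pairing. Qed.

Lemma lerp1 z w : lerp z w 1 = w.
Proof. by rewrite /lerp [RHS]surjective_pairing; congr pair; ring. Qed.

End EuclideanTopology.

Section CurveAlongArc.
Variables (R : realType) (X : set (R * R)) (A B : R * R) (gamma : R -> R * R) (a b : R).
Hypothesis gs : shortest_curve X A B gamma a b.
Variables (p : {poly R}) (th : R).

Lemma shortest_comp_continuous (f : R * R -> R) s t : continuous f ->
  a <= s -> t <= b -> {within `[s, t], continuous (f \o gamma)}.
Proof.
move=> cf ss tb.
have cg : {within `[s, t], continuous gamma}.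
  apply: continuous_subspaceW (shortest_continuous gs) => u/=.
  by rewrite !in_itv/= => /andP[su ut]; rewrite (le_trans ss su) (le_trans ut tb).
by move=> u; apply: (@continuous_comp (subspace `[s, t]) _ _ gamma f u); [exact: cg|exact: cf].
Qed.

(** Were the abscissa at [u] outside the range between those at [s] and [t], the curve would, by the
    intermediate value theorem, pass twice through one point of the graph, with [u] in between;
    [shortest_const] then puts [gamma u] at an end. *)
Lemma on_arc_interval (J : set R) s t u : is_interval J ->
  a <= s -> t <= b -> s <= u <= t ->
  (forall v, s <= v <= t -> Phi p th (gamma v) = 0) ->
  J (rotX th (gamma s)) -> J (rotX th (gamma t)) -> J (rotX th (gamma u)).
Proof.
move=> iJ ss tb /andP[su ut] onG Js Jt.
pose f := rotX th \o gamma.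
have cf s' t' : a <= s' -> t' <= b -> {within `[s', t'], continuous f}.
  exact/shortest_comp_continuous/rotX_continuous.
have fI v w : s <= v <= t -> s <= w <= t -> f v = f w -> gamma v = gamma w.
  by move=> vst wst fvw; rewrite -(Gam_rotX (onG v vst)) -(Gam_rotX (onG w wst)) [rotX _ _]fvw.
have st := le_trans su ut.
(* The value [f t] is already taken at some [c] in [[s, u]], so the curve is constant on [[c, t]],
   which contains [u]. *)
have caseT : Num.min (f s) (f u) <= f t <= Num.max (f s) (f u) -> J (f u).
  move=> h; have [|c] := IVT su _ h; first by apply: cf => //; exact: le_trans tb.
  rewrite in_itv/= => /andP[sc cu] fc.
  have ct : gamma c = gamma t.
    by apply: fI => //; rewrite ?lexx ?st ?sc ?(le_trans cu ut).
  have -> : f u = f t; last exact: Jt.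
  congr (rotX th _); rewrite -ct.
  by apply: (shortest_const gs _ tb _ ct); rewrite ?(le_trans ss sc) ?cu.
have caseS : Num.min (f u) (f t) <= f s <= Num.max (f u) (f t) -> J (f u).
  move=> h; have [|c] := IVT ut _ h; first by apply: cf => //; exact: le_trans su.
  rewrite in_itv/= => /andP[uc ct] fc.
  have cs : gamma s = gamma c.
    by apply: fI => //; rewrite ?lexx ?st// ?(le_trans su uc) ?ct.
  have -> : f u = f s; last exact: Js.
  congr (rotX th _).
  by apply: (shortest_const gs ss (le_trans ct tb) _ cs); rewrite su uc.
have [h1|h1] := leP (f s) (f u); have [h2|h2] := leP (f u) (f t).
- by apply: (iJ _ _ Js Jt); rewrite h1.
- have [h3|h3] := leP (f s) (f t).
    by apply: caseT; rewrite ge_min le_max h3 (ltW h2) orbT.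
  by apply: caseS; rewrite ge_min le_max h1 (ltW h3) orbT.
- have [h3|h3] := leP (f s) (f t).
    by apply: caseS; rewrite ge_min le_max (ltW h1) h3 orbT.
  by apply: caseT; rewrite ge_min le_max h2 (ltW h3) orbT.
- by apply: (iJ _ _ Jt Js); rewrite (ltW h2) (ltW h1).
Qed.

(** Between two visits it suffices to stay on the whole graph: [on_arc_interval] then keeps the
    curve in the arc, so the visits form one interval of times. *)
Lemma curve_sub_arc_interacts (J : set R) : is_interval J ->
  (forall s t u, a <= s -> t <= b -> s <= u <= t ->
     (Gam p th @` J) (gamma s) -> (Gam p th @` J) (gamma t) ->
     Phi p th (gamma u) = 0) ->
  interacts_finitely gamma a b (Gam p th @` J).
Proof.
move=> iJ onG; apply: interval_interacts => s t u ss tb sut es et.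
have onst v : s <= v <= t -> Phi p th (gamma v) = 0 by move=> vst; exact: (onG s t).
exists (rotX th (gamma u)); last by apply: Gam_rotX; exact: onst.
apply: (on_arc_interval iJ ss tb sut onst).
- by case: es => x Jx <-; rewrite rotX_Gam.
- by case: et => x Jx <-; rewrite rotX_Gam.
Qed.

(** Here [c] is the centre of a ball in which [Phi >= 0] is the only constraint. A positive maximum
    of [Phi] along the curve would be attained inside a chord that the curve traces, against
    [Phi_lerp_lt_max]. *)
Lemma convex_barrier (t0 r : R) (c : R * R) s t u :
  (forall z, enorm (z - c) < r -> 0 <= Phi p th z -> X z) ->
  rotX th c = t0 ->
  X `<=` poly_half_plane p th ->
  (forall v, `|v - t0| < r -> 0 < (deriv (deriv p)).[v]) ->
  a <= s -> t <= b -> s <= u <= t ->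
  (forall v, s <= v <= t -> enorm (gamma v - c) < r) ->
  Phi p th (gamma s) = 0 -> Phi p th (gamma t) = 0 ->
  Phi p th (gamma u) = 0.
Proof.
move=> locX xic Xsub p2 ss tb /andP[su ut] near_c Ps Pt.
have st := le_trans su ut.
pose f := Phi p th \o gamma.
have [|m] := EVT_max st (f := f); first by apply: shortest_comp_continuous => //; exact: Phi_continuous.
rewrite in_itv/= => /andP[sm mt] mmax.
have Xg v : s <= v <= t -> X (gamma v).
  by move=> /andP[sv vt]; apply: (shortest_in gs); rewrite (le_trans ss sv) (le_trans vt tb).
have Pu0 : 0 <= Phi p th (gamma u) by apply: Xsub; apply: Xg; rewrite su.
have [m0|m0] := leP (f m) 0.
  by apply/eqP; rewrite eq_le Pu0 andbT (le_trans _ m0)//; apply: mmax; rewrite in_itv/= su.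
exfalso.
set P := gamma m.
have [e e0 he] : exists2 e : R, 0 < e &
    forall w, enorm (w - P) < e -> 0 < Phi p th w /\ enorm (w - c) < r.
  apply: nbhs_enorm; apply: filterI.
    exact: (cvgr_gt _ (@Phi_continuous R p th P) _ m0).
  apply: (cvgr_lt _ (@enormB_continuous R c P) r).
  by apply: near_c; rewrite sm.
have eP : enorm (P - P) = 0 by rewrite subrr /enorm/= expr0n/= addr0 sqrtr0.
(* On the [e]-ball about [P] the value of [Phi] is positive, so both end points lie outside it. *)
have far v : Phi p th (gamma v) = 0 -> e <= enorm (gamma v - P).
  by move=> h; rewrite leNgt; apply/negP => /he[]; rewrite h ltxx.
pose g v := enorm (gamma v - P).
have cg s' t' : a <= s' -> t' <= b -> {within `[s', t'], continuous g}.
  by apply: (shortest_comp_continuous (f := fun z => enorm (z - P))); exact: enormB_continuous.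
(* The curve crosses the circle of radius [e / 2] about [P] both before and after time [m]; the
   chord between the crossings lies in [X]. *)
have [u0 u0I gu0] : exists2 u0, u0 \in `[s, m] & g u0 = e / 2.
  apply: IVT => //; first by apply: cg => //; exact: le_trans tb.
  have := far s Ps; rewrite -/(g s) (_ : g m = 0)// ge_min le_max => h.
  by apply/andP; split; apply/orP; [right|left]; lra.
have [u2 u2I gu2] : exists2 u2, u2 \in `[m, t] & g u2 = e / 2.
  apply: IVT => //; first by apply: cg => //; exact: le_trans sm.
  have := far t Pt; rewrite -/(g t) (_ : g m = 0)// ge_min le_max => h.
  by apply/andP; split; apply/orP; [left|right]; lra.
move: u0I u2I; rewrite !in_itv/= => /andP[su0 u0m] /andP[mu2 u2t].
have g0 : enorm (gamma u0 - P) < e by rewrite -/(g u0) gu0; lra.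
have g2 : enorm (gamma u2 - P) < e by rewrite -/(g u2) gu2; lra.
have segX : seg (gamma u0) (gamma u2) `<=` X.
  move=> _ [l l01 ->]; have [h1 h2] := he _ (lerp_ball g0 g2 l01).
  exact: locX h2 (ltW h1).
have [|l /andP[l0 l1] Pl] := shortest_seg gs (le_trans ss su0) (le_trans u2t tb) _ segX (u := m).
  by rewrite u0m.
rewrite -/P in Pl.
(* Since [P] differs from both ends of the chord, its parameter [l] is strictly between 0 and 1. *)
have neq v : g v = e / 2 -> P <> gamma v.
  by move=> gv Pv; move: gv; rewrite /g -Pv eP; lra.
have l0' : 0 < l.
  rewrite lt_neqAle l0 andbT; apply/eqP => l0E.
  by apply: (neq u0 gu0); rewrite Pl -l0E lerp0.
have l1' : l < 1.
  rewrite lt_neqAle l1 andbT; apply/eqP => l1E.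
  by apply: (neq u2 gu2); rewrite Pl l1E lerp1.
have g02 : gamma u0 <> gamma u2.
  by move=> E; apply: (neq u0 gu0); rewrite Pl -E /lerp !subrr !mulr0 !addr0 -surjective_pairing.
have xr v : s <= v <= t -> `|rotX th (gamma v) - t0| < r.
  by move=> vst; rewrite -xic; apply: le_lt_trans (rotX_lip _ _ _) _; exact: near_c.
have su0t : s <= u0 <= t by rewrite su0 (le_trans u0m mt).
have su2t : s <= u2 <= t by rewrite (le_trans sm mu2).
have : Phi p th (lerp (gamma u0) (gamma u2) l) <
    Num.max (Phi p th (gamma u0)) (Phi p th (gamma u2)).
  by apply: Phi_lerp_lt_max p2 _ _ => //; [rewrite l0' l1'|exact: xr|exact: xr].
rewrite -Pl ltNge ge_max; apply/negP; rewrite negbK.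
by apply/andP; split; apply: mmax; rewrite in_itv.
Qed.

(** Two visits force the curve along their chord, in whose interior [Phi] is positive. So of three
    successive visits the middle one is at the point of an outer one. *)
Lemma strictly_concave_arc_interacts (t0 r : R) (J : set R) :
  (forall v, `|v - t0| < r -> (deriv (deriv p)).[v] < 0) ->
  (forall x, J x -> `|x - t0| < r) ->
  (forall x y, J x -> J y -> seg (Gam p th x) (Gam p th y) `<=` X) ->
  interacts_finitely gamma a b (Gam p th @` J).
Proof.
move=> p2 Jr JX; set e := Gam p th @` J.
have mid s t u : a <= s -> t <= b -> s <= u <= t -> e (gamma s) -> e (gamma u) ->
    e (gamma t) -> gamma u = gamma s \/ gamma u = gamma t.
  move=> ss tb sut [x Jx xs] [z Jz zu] [y Jy yt].
  have sX := JX x y Jx Jy.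
  have := shortest_seg gs ss tb sut; rewrite -xs -yt => /(_ sX)[l /andP[l0 l1] E].
  have [l0E|l0n] := eqVneq l 0; first by left; rewrite E l0E lerp0.
  have [l1E|l1n] := eqVneq l 1; first by right; rewrite E l1E lerp1.
  have [xy|xy] := eqVneq x y.
    by left; rewrite E xy /lerp !subrr !mulr0 !addr0 -surjective_pairing.
  have l01 : 0 < l < 1 by rewrite !lt_neqAle eq_sym l0n l0 l1n.
  have := Phi_chord_gt0 th xy l01 p2 (Jr _ Jx) (Jr _ Jy).
  by rewrite -E -zu Phi_Gam ltxx.
(* If two visits are at distinct points, these are the only points visited; otherwise all visits are
   at one point. *)
have [[s [t [ss st tb [es et] nst]]]|single] := pselect (exists s t,
    [/\ a <= s, s <= t, t <= b, e (gamma s) /\ e (gamma t) & gamma s <> gamma t]).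
  apply: (two_points_interacts (z1 := gamma s) (z2 := gamma t) gs) => u /andP[au ub] eu.
  have [us|su] := leP u s.
    have [|E|//] := mid u t s au tb _ eu es et; first by rewrite us.
    by left; rewrite E.
  have [ut|tu] := leP u t; first by apply: mid => //; rewrite (ltW su).
  have [|E|E] := mid s u t ss ub _ es et eu; first by rewrite st ltW.
  - by case: nst.
  - by right; rewrite E.
apply: interval_interacts => s t u ss tb sut es et.
have E : gamma s = gamma t.
  case/andP: sut => su ut.
  by apply: contrapT => nst; apply: single; exists s, t; split => //; exact: le_trans ut.
by rewrite (shortest_const gs ss tb sut E).
Qed.

End CurveAlongArc.

(** The detour along the arc has length at most [2 * rho * K <= r / 2], and the first visit is
    within [r / 2] of the centre. Hence the curve stays in the ball of radius [r] between visits,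
    where [convex_barrier] applies. *)
Lemma strictly_convex_arc_interacts (R : realType) (X : set (R * R)) A B gamma
    (a b : R) (p : {poly R}) (th t0 r rho K : R) (J : set R) :
  shortest_curve X A B gamma a b ->
  (forall z, enorm (z - Gam p th t0) < r -> 0 <= Phi p th z -> X z) ->
  X `<=` poly_half_plane p th ->
  (forall v, `|v - t0| < r -> 0 < (deriv (deriv p)).[v]) ->
  0 <= K -> 2 * rho * K <= r / 2 ->
  (forall v, `|v - t0| < rho -> enorm (Gam p th v - Gam p th t0) < r / 2) ->
  (forall v, `|v - t0| < rho ->
     enorm ((deriv (Gam1 p th)).[v], (deriv (Gam2 p th)).[v]) <= K) ->
  is_interval J -> (forall x, J x -> `|x - t0| < rho) ->
  interacts_finitely gamma a b (Gam p th @` J).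
Proof.
move=> gs locX Xsub p2 K0 rhoK Gr GK iJ Jrho.
apply: (curve_sub_arc_interacts gs iJ) => s t u ss tb sut [x Jx xs] [y Jy yt].
case/andP: (sut) => su ut; have [ts|st] := leP t s.
  rewrite (_ : u = s); first by rewrite -xs Phi_Gam.
  by apply/eqP; rewrite eq_le su (le_trans ut).
have ts0 : 0 < t - s by rewrite subr_gt0.
have tsn0 : t - s != 0 by lra.
have xr := Jrho _ Jx; have yr := Jrho _ Jy.
apply: (convex_barrier gs locX (rotX_Gam _ _ _) Xsub p2 ss tb sut);
  rewrite -?xs -?yt ?Phi_Gam// => v svt.
pose k := (y - x) / (t - s).
(* Affine change of parameter carrying the times [s], [t] to the arc parameters [x], [y], in either
   order of the latter. Composition keeps the competitor polynomial. *)
pose ell : {poly R} := x%:P + k%:P * ('X - s%:P).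
have ellE w : ell.[w] = x + k * (w - s) by rewrite /ell !hornerE.
have dell : deriv ell = k%:P.
  rewrite /ell derivD derivC add0r derivM derivC mul0r add0r derivB derivX derivC.
  by rewrite subr0 mulr1.
pose delta w := ((Gam1 p th \Po ell).[w], (Gam2 p th \Po ell).[w]).
have deltaE w : delta w = Gam p th ell.[w] by rewrite GamE /delta !horner_comp.
have ellr w : s <= w <= t -> `|ell.[w] - t0| < rho.
  move=> /andP[sw wt]; rewrite ellE.
  pose l := (w - s) / (t - s).
  have -> : x + k * (w - s) = x + l * (y - x) by rewrite /k /l; ring.
  have l0 : 0 <= l by rewrite divr_ge0 ?subr_ge0// ltW.
  have l1 : l <= 1 by rewrite ler_pdivrMr// mul1r lerD2r.
  move: xr yr; rewrite !ltr_norml => /andP[x1 x2] /andP[y1 y2].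
  have [->|ln0] := eqVneq l 0; first by apply/andP; split; lra.
  have lp : 0 < l by rewrite lt_neqAle eq_sym ln0.
  have h1 : 0 <= 1 - l by rewrite subr_ge0.
  have := mulr_ge0 h1 (ltW (_ : 0 < x - t0 + rho)).
  have := mulr_ge0 h1 (ltW (_ : 0 < rho - (x - t0))).
  have := mulr_gt0 lp (_ : 0 < y - t0 + rho).
  have := mulr_gt0 lp (_ : 0 < rho - (y - t0)).
  move=> /(_ ltac:(lra)) h2 /(_ ltac:(lra)) h3 /(_ ltac:(lra)) h4 /(_ ltac:(lra)) h5.
  by apply/andP; split; nra.
have h : enorm (gamma v - gamma s) + enorm (gamma t - gamma v) <= `|k| * K * (t - s).
  apply: (shortest_detour gs (delta := delta)) => //.
  - exact: C2_poly.
  - by rewrite deltaE ellE subrr mulr0 addr0.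
  - by rewrite deltaE ellE /k divfK// addrC subrK.
  - move=> w swt; rewrite deltaE; apply: locX; last by rewrite Phi_Gam.
    apply: lt_trans (Gr _ (ellr w swt)) _.
    by have := Gr _ (ellr w swt); have := enorm_ge0 (Gam p th ell.[w] - Gam p th t0); lra.
  - move=> w swt; rewrite speed_poly !deriv_comp dell !hornerM !horner_comp hornerC.
    rewrite (_ : (_, _) = (k * (deriv (Gam1 p th)).[ell.[w]],
                           k * (deriv (Gam2 p th)).[ell.[w]])).
      by rewrite (enormZ k (_, _)) ler_wpM2l// GK// ellr.
    by congr pair; rewrite mulrC.
have kE : `|k| * K * (t - s) = `|y - x| * K.
  by rewrite /k normrM normfV (gtr0_norm ts0); field.
have yx : `|y - x| <= 2 * rho.
  move: xr yr; rewrite !ltr_norml => /andP[x1 x2] /andP[y1 y2].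
  by rewrite ler_norml; apply/andP; split; lra.
have : enorm (gamma v - gamma s) <= r / 2.
  apply: le_trans rhoK; apply: (@le_trans _ _ (`|y - x| * K)); last exact: ler_wpM2r.
  by rewrite -kE; apply: le_trans h; rewrite lerDl enorm_ge0.
move=> h1; have := Gr _ xr; rewrite xs => h2.
rewrite (_ : _ - _ = (gamma v - gamma s) + (gamma s - Gam p th t0)); last by rewrite addrA subrK.
by apply: le_lt_trans (ler_enormD _ _) _; lra.
Qed.

(** * Boundary curves with a common arc *)

Section Coincidence.
Variable R : realType.
Implicit Types (p q : {poly R}) (th ph : R).

(* The cosine and the sine of ph - th. *)
Definition dcos th ph := cos th * cos ph + sin th * sin ph.
Definition dsin th ph := cos th * sin ph - sin th * cos ph.

(* The restriction of Phi q ph to the curve Gam p th; see crossingE. *)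
Definition crossing p th q ph : {poly R} :=
  q \Po (dcos th ph *: 'X + dsin th ph *: p) - (dcos th ph *: p - dsin th ph *: 'X).

Lemma crossingE p th q ph t : (crossing p th q ph).[t] = Phi q ph (Gam p th t).
Proof.
rewrite /crossing hornerD horner_comp hornerN !hornerD hornerN !hornerZ hornerX PhiE.
by congr (q.[_] - _); rewrite /dcos /dsin /rotX /rotY /=; ring.
Qed.

Lemma dcos2Ddsin2 th ph : dcos th ph ^+ 2 + dsin th ph ^+ 2 = 1.
Proof.
have -> : dcos th ph ^+ 2 + dsin th ph ^+ 2 =
  (cos th ^+ 2 + sin th ^+ 2) * (cos ph ^+ 2 + sin ph ^+ 2) by rewrite /dcos /dsin; ring.
by rewrite !cos2Dsin2 mulr1.
Qed.

Lemma cos_dcos th ph : cos ph = dcos th ph * cos th - dsin th ph * sin th.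
Proof.
rewrite [RHS](_ : _ = cos ph * (cos th ^+ 2 + sin th ^+ 2)); last by rewrite /dcos /dsin; ring.
by rewrite cos2Dsin2 mulr1.
Qed.

Lemma sin_dcos th ph : sin ph = dcos th ph * sin th + dsin th ph * cos th.
Proof.
rewrite [RHS](_ : _ = sin ph * (cos th ^+ 2 + sin th ^+ 2)); last by rewrite /dcos /dsin; ring.
by rewrite cos2Dsin2 mulr1.
Qed.

(** Suppose [S] is nonzero. Degrees force [q] to be affine, and then the leading and linear
    coefficients give [q1 * S = C] and [q1 * C = - S], so that [C ^ 2 + S ^ 2 = 0] instead of 1. *)
Lemma crossing_eq0_dsin p th q ph : (2 < size p)%N ->
  crossing p th q ph = 0 -> dsin th ph = 0.
Proof.
move=> sp /eqP; rewrite /crossing subr_eq0.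
have := dcos2Ddsin2 th ph.
set C := dcos th ph; set S := dsin th ph => CS /eqP E.
apply/eqP; apply: contraT => S0.
have lin (c : R) : (size (c *: 'X : {poly R}) <= 2)%N.
  by apply: leq_trans (size_scale_leq _ _) _; rewrite size_polyX.
have sF : size (C *: 'X + S *: p) = size p.
  rewrite addrC size_polyDl; first by rewrite size_scale.
  by rewrite [X in (_ < X)%N]size_scale//; exact: leq_ltn_trans (lin _) sp.
have sG : (size (C *: p - S *: 'X)%R <= size p)%N.
  apply: leq_trans (size_polyD _ _) _; rewrite geq_max size_scale_leq size_polyN.
  exact: leq_trans (lin _) (ltnW sp).
(* The degree of a composition is the product of the degrees, and the right-hand side has degree at
   most that of [p], which is positive. *)
have sq : (size q <= 2)%N.
  have := size_comp_poly q (C *: 'X + S *: p); rewrite E sF => h.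
  have := leq_sub2r 1 sG; rewrite !subn1 h.
  have d0 : (0 < (size p).-1)%N by case: (size p) sp => [//|[//|n]].
  rewrite -[leqRHS]mul1n leq_pmul2r//.
  by case: (size q) => [//|[//|[//|n]]].
have qE : q = (q`_0)%:P + q`_1 *: 'X.
  apply/polyP => i; rewrite coefD coefC coefZ coefX.
  case: i => [|[|i]]; rewrite /= ?mulr0 ?mulr1 ?addr0 ?add0r//.
  by rewrite nth_default// (leq_trans sq).
have comp : q \Po (C *: 'X + S *: p) = (q`_0)%:P + q`_1 *: (C *: 'X + S *: p).
  by rewrite {1}qE comp_polyD comp_polyC comp_polyZ comp_polyX.
rewrite comp in E.
have coefE i : (q`_0 *+ (i == 0)%N) + q`_1 * (C * (i == 1%N)%:R + S * p`_i) =
    C * p`_i - S * (i == 1%N)%:R.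
  have := congr1 (fun r : {poly R} => r`_i) E.
  rewrite !coefD coefN !coefZ coefD !coefZ coefX coefC.
  by case: i => [|i]; rewrite /= ?mulr1n ?mulr0n.
have lp : p`_(size p).-1 != 0.
  by rewrite -[p`__]/(lead_coef p) lead_coef_eq0 -size_poly_gt0 (leq_trans _ sp).
have h1 := coefE (size p).-1; have h2 := coefE 1%N.
have [n spn] : exists n, size p = n.+3 by case: (size p) sp => [|[|[|n]]]// _; exists n.
move: h1 h2; rewrite spn/= in lp *; rewrite !mulr0n !mulr0 !add0r subr0 !mulr1.
move=> h1 h2.
have h3 : q`_1 * S = C.
  by apply: (mulIf lp); rewrite -h1 mulrA.
have h4 : q`_1 * C = - S.
  move: h2; rewrite mulrDr mulrA h3; lra.
have CC : C * C = - (S * S) by rewrite -{1}h3 mulrAC h4 mulNr.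
by move: CS CC; rewrite !expr2; lra.
Qed.

(** The two frames agree up to a half turn, since [dcos] is 1 or -1. The half turn replaces [p] by
    [- p (- t)] and changes the sign of [Phi]. *)
Lemma crossing_eq0 p th q ph : (2 < size p)%N -> crossing p th q ph = 0 ->
  (forall z, Phi q ph z = Phi p th z) \/ (forall z, Phi q ph z = - Phi p th z).
Proof.
move=> sp E; have S0 := crossing_eq0_dsin sp E.
have qp t : q.[dcos th ph * t] = dcos th ph * p.[t].
  have := congr1 (horner^~ t) E; rewrite /crossing S0 !scale0r addr0 subr0.
  by rewrite !hornerE horner_comp !hornerE => /eqP; rewrite subr_eq0 => /eqP.
have /eqP : dcos th ph ^+ 2 = 1.
  by have := dcos2Ddsin2 th ph; rewrite S0 expr0n/= addr0.
rewrite sqrf_eq1 => /orP[] /eqP C1.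
- left=> z; rewrite /Phi (cos_dcos th ph) (sin_dcos th ph) S0 C1.
  by have := qp (rotX th z); rewrite C1 !mul1r /rotX => <-; rewrite !mul0r subr0 addr0.
- right=> z; rewrite /Phi (cos_dcos th ph) (sin_dcos th ph) S0 C1.
  have := qp (rotX th z); rewrite C1 !mulN1r !mul0r subr0 addr0 /rotX => h.
  rewrite (_ : z.1 * - cos th + z.2 * - sin th = - (z.1 * cos th + z.2 * sin th)); last by ring.
  by rewrite h; ring.
Qed.

End Coincidence.

(** * Tameness of short boundary arcs *)

Definition tame (R : realType) (X e : set (R * R)) : Prop :=
  forall A B gamma a b, shortest_curve X A B gamma a b ->
    interacts_finitely gamma a b e.

Section Neighbourhoods.
Variables (R : realType) (T : topologicalType) (f : T -> R) (x : T) (c : R).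
Hypothesis fx : {for x, continuous f}.

Lemma nbhs_gt_continuous : c < f x -> nbhs x [set y | c < f y].
Proof. by move=> cx; exact: (fx (lt_nbhsr cx)). Qed.

Lemma nbhs_lt_continuous : f x < c -> nbhs x [set y | f y < c].
Proof. by move=> cx; exact: (fx (lt_nbhsl cx)). Qed.

End Neighbourhoods.

Section TameArcs.
Variables (R : realType) (n : nat) (p : 'I_n -> {poly R}) (th : 'I_n -> R).
Let X := \bigcap_(i in setT) poly_half_plane (p i) (th i).

Lemma affine_poly (q : {poly R}) : deriv (deriv q) = 0 ->
  forall x y l, q.[x + l * (y - x)] = q.[x] + l * (q.[y] - q.[x]).
Proof.
move=> q2 x y l.
have sq : (size q <= 2)%N.
  have := size_deriv (deriv q); rewrite q2 size_poly0 size_deriv.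
  by case: (size q) => [//|[//|[//|m]]].
have qE t : q.[t] = q`_0 + q`_1 * t.
  by rewrite (horner_coef_wide _ sq) !big_ord_recl big_ord0 /= expr0 expr1 mulr1 addr0.
by rewrite !qE; ring.
Qed.

Lemma near_dist_lt (t0 : R) (P : set R) : (\forall x \near t0, P x) ->
  exists2 e : R, 0 < e & forall x, `|x - t0| < e -> P x.
Proof.
by move=> /nbhs_ballP[e e0 h]; exists e => // x xe; apply: h; rewrite /ball/= distrC.
Qed.

Lemma horner_continuous_at (q : {poly R}) (t0 : R) : {for t0, continuous (horner q)}.
Proof. exact: continuous_horner. Qed.

Let cr i j := crossing (p i) (th i) (p j) (th j).

Lemma near_crossing i t0 : (forall j, cr i j = 0 \/ 0 < (cr i j).[t0]) ->
  \forall x \near t0, forall j, cr i j = 0 \/ 0 < (cr i j).[x].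
Proof.
move=> h.
apply: (@filter_forall _ _ (fun j x => cr i j = 0 \/ 0 < (cr i j).[x]) (nbhs t0)) => j.
have [->|hj] := h j.
  by apply: filterE => x; left.
have hx := nbhs_gt_continuous (@horner_continuous_at (cr i j) t0) hj.
by apply: (@filterS _ (nbhs t0) _ _ _ _ hx) => x; right.
Qed.

Lemma crossing_in i x : (forall j, cr i j = 0 \/ 0 < (cr i j).[x]) ->
  X (Gam (p i) (th i) x).
Proof.
move=> h j _; rewrite /poly_half_plane /= -crossingE -/(cr i j).
by have [->|/ltW//] := h j; rewrite horner0.
Qed.

(** The radius is chosen before the interval [J], so that the result covers every short dyadic arc
    around [t0]. *)
Lemma arc_tame i t0 :
  deriv (deriv (p i)) = 0 \/ (deriv (deriv (p i))).[t0] != 0 ->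
  (forall j, cr i j = 0 \/ 0 < (cr i j).[t0]) ->
  exists2 rho : R, 0 < rho & forall J, is_interval J ->
    (forall x, J x -> `|x - t0| < rho) -> tame X (Gam (p i) (th i) @` J).
Proof.
move=> p2 h; set G := Gam (p i) (th i).
have [e e0 he] := near_dist_lt (near_crossing h).
have eX x : `|x - t0| < e -> X (G x) by move=> /he; exact: crossing_in.
have Xi : X `<=` poly_half_plane (p i) (th i) by move=> z; apply.
(* Affine case: the arc is convex. *)
have [p20|p2n0] := eqVneq (deriv (deriv (p i))) 0.
  exists e => // J iJ Je A B gamma a b gs.
  apply: (convex_interacts gs); first by move=> _ [x Jx <-]; exact/eX/Je.
  move=> _ _ [x Jx <-] [y Jy <-] _ [l /andP[l0 l1] ->].
  exists (x + l * (y - x)).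
    have [xy|/ltW yx] := leP x y.
      by apply: (iJ x y) => //; apply/andP; split; nra.
    by apply: (iJ y x) => //; apply/andP; split; nra.
  by rewrite /G /Gam /lerp /= affine_poly//; congr pair; ring.
have {p2}p2 : (deriv (deriv (p i))).[t0] != 0 by case: p2 => // p20; rewrite p20 eqxx in p2n0.
have sp : (2 < size (p i))%N.
  have : (0 < size (deriv (deriv (p i))))%N by rewrite size_poly_gt0.
  by rewrite !size_deriv; case: (size _) => [//|[//|[//|m]]].
(* With an opposite constraint, [X] lies on the curve itself. *)
have [[j Phij]|noopp] := pselect (exists j, forall z,
    Phi (p j) (th j) z = - Phi (p i) (th i) z).
  exists e => // J iJ Je A B gamma a b gs.
  apply: (curve_sub_arc_interacts gs iJ) => s t u ss tb /andP[su ut] _ _.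
  have Xu : X (gamma u).
    by apply: (shortest_in gs); rewrite (le_trans ss su) (le_trans ut tb).
  have := Xu i I; have := Xu j I; rewrite /poly_half_plane/= Phij oppr_ge0 => h1 h2.
  by apply/eqP; rewrite eq_le h1.
have [r1 r10 hr1] : exists2 r : R, 0 < r & forall z, enorm (z - G t0) < r ->
    forall j, cr i j = 0 \/ 0 < Phi (p j) (th j) z.
  apply: nbhs_enorm.
  apply: (@filter_forall _ _ (fun j z => cr i j = 0 \/ 0 < Phi (p j) (th j) z) (nbhs (G t0))) => j.
  have [->|hj] := h j.
    by apply: filterE => x; left.
  rewrite crossingE in hj.
  have hx := nbhs_gt_continuous (@Phi_continuous R (p j) (th j) (G t0)) hj.
  by apply: (@filterS _ (nbhs (G t0)) _ _ _ _ hx) => z; right.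
(* Near [G t0] only the [i]-th constraint matters: the others are positive there, or vanish on the
   curve and then coincide with it, opposites being excluded. *)
have locX r : r <= r1 -> forall z, enorm (z - G t0) < r -> 0 <= Phi (p i) (th i) z -> X z.
  move=> rr1 z zr Pz j _; have [cj|/ltW//] := hr1 z (lt_le_trans zr rr1) j.
  have [Ej|Ej] := crossing_eq0 sp cj; first by rewrite /poly_half_plane/= Ej.
  by exfalso; apply: noopp; exists j.
have cp2 := @horner_continuous_at (deriv (deriv (p i))) t0.
have Gnear r : 0 < r -> \forall v \near t0, enorm (G v - G t0) < r.
  move=> r0; have cG : {for t0, continuous (fun v => enorm (G v - G t0))}.
    apply: (@continuous_comp _ _ _ G (fun z => enorm (z - G t0))).
      rewrite /G; rewrite (_ : Gam _ _ = fun t => ((Gam1 (p i) (th i)).[t], (Gam2 (p i) (th i)).[t])).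
        exact: (cvg_pair (@horner_continuous_at (Gam1 (p i) (th i)) t0)
                         (@horner_continuous_at (Gam2 (p i) (th i)) t0)).
      by apply/funext => t; rewrite GamE.
    exact: enormB_continuous.
  by apply: (nbhs_lt_continuous cG); rewrite subrr /enorm/= expr0n/= addr0 sqrtr0.
move: p2; rewrite neq_lt => /orP[p2|p2].
  have [r2 r20 hr2] := near_dist_lt (nbhs_lt_continuous cp2 p2).
  have [r3 r30 hr3] := near_dist_lt (Gnear _ r10).
  exists (Num.min r2 r3); first by rewrite lt_min r20.
  move=> J iJ Jr A B gamma a b gs.
  have Jr2 x : J x -> `|x - t0| < r2 by move=> /Jr; rewrite lt_min => /andP[].
  have Jr3 x : J x -> `|x - t0| < r3 by move=> /Jr; rewrite lt_min => /andP[].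
  apply: (strictly_concave_arc_interacts gs hr2 Jr2).
  move=> x y Jx Jy _ [l /[dup] l01 /andP[l0 l1] ->]; apply: (locX r1 (lexx _)).
    by apply: lerp_ball l01; apply: hr3; exact: Jr3.
  have [l0E|l0n] := eqVneq l 0; first by rewrite l0E lerp0 Phi_Gam.
  have [l1E|l1n] := eqVneq l 1; first by rewrite l1E lerp1 Phi_Gam.
  have [xy|xy] := eqVneq x y.
    by rewrite xy /lerp !subrr !mulr0 !addr0 -surjective_pairing Phi_Gam.
  have l01' : 0 < l < 1 by rewrite !lt_neqAle eq_sym l0n l0 l1n.
  by rewrite ltW//; exact: (Phi_chord_gt0 _ xy l01' hr2 (Jr2 _ Jx) (Jr2 _ Jy)).
have [r2 r20 hr2] := near_dist_lt (nbhs_gt_continuous cp2 p2).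
pose r := Num.min r1 r2.
have r0 : 0 < r by rewrite lt_min r10.
have rr1 : r <= r1 by rewrite ge_min lexx.
have rr2 : r <= r2 by rewrite ge_min lexx orbT.
have r20' : 0 < r / 2 by lra.
have [r3 r30 hr3] := near_dist_lt (Gnear _ r20').
pose D v := enorm ((deriv (Gam1 (p i) (th i))).[v], (deriv (Gam2 (p i) (th i))).[v]).
pose K := D t0 + 1.
have K0 : 0 < K by rewrite /K ltr_wpDl// enorm_ge0.
have [r4 r40 hr4] : exists2 e : R, 0 < e & forall v, `|v - t0| < e -> D v < K.
  apply: near_dist_lt.
  have cD : {for t0, continuous D}.
    apply: (@continuous_comp _ _ _ (fun v => ((deriv (Gam1 (p i) (th i))).[v],
       (deriv (Gam2 (p i) (th i))).[v])) (@enorm R)); last exact: enorm_continuous.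
    exact: (cvg_pair (@horner_continuous_at (deriv (Gam1 (p i) (th i))) t0)
                     (@horner_continuous_at (deriv (Gam2 (p i) (th i))) t0)).
  by apply: (nbhs_lt_continuous cD); rewrite /K ltrDl.
(* Chosen so that [rho <= r5] gives [2 * rho * K <= r / 2]. *)
pose r5 := r / (4 * K).
have r50 : 0 < r5 by rewrite divr_gt0// mulr_gt0.
exists (Num.min r5 (Num.min r3 r4)); first by rewrite !lt_min r50 r30.
move=> J iJ Jr A B gamma a b gs; set rho := Num.min r5 _ in Jr *.
have rho5 : rho <= r5 by rewrite ge_min lexx.
have rho3 v : `|v - t0| < rho -> `|v - t0| < r3.
  by move=> /lt_le_trans; apply; rewrite /rho !ge_min lexx !orbT.
have rho4 v : `|v - t0| < rho -> `|v - t0| < r4.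
  by move=> /lt_le_trans; apply; rewrite /rho !ge_min lexx !orbT.
apply: (strictly_convex_arc_interacts gs (locX r rr1) Xi _ (ltW K0) _ _ _ iJ Jr).
- by move=> v vr; apply: hr2; exact: lt_le_trans rr2.
- have : rho * (4 * K) <= r by rewrite -ler_pdivlMr// mulr_gt0.
  lra.
- by move=> v /rho3 /hr3.
- by move=> v /rho4 /hr4 /ltW.
Qed.

End TameArcs.

(** * Cells *)

Section CellHomeomorphisms.
Variable R : realType.

Lemma rV_continuous_at (T : topologicalType) (d : nat) (h : T -> 'rV[R]_d) (x : T) :
  (forall j, {for x, continuous (fun y => h y ord0 j)}) -> {for x, continuous h}.
Proof.
move=> ch A [P MP PA].
have : nbhs x [set y | forall j, P ord0 j (h y ord0 j)].
  apply: (@filter_forall _ _ (fun j y => P ord0 j (h y ord0 j)) (nbhs x)) => j.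
  exact: (ch j _ (MP ord0 j)).
apply: (@filterS _ (nbhs x)) => y Py; apply: PA => i j; rewrite ord1; exact: Py.
Qed.

Lemma open_interval_homeo (u v : R) : u < v -> exists f g : R -> R,
  [/\ continuous f, (forall x, u < f x < v), cancel f g,
      (forall y, u < y < v -> f (g y) = y)
    & (forall y, u < y < v -> {for y, continuous g})].
Proof.
move=> uv; pose m := (u + v) / 2; pose h := (v - u) / 2.
have h0 : 0 < h by rewrite /h; lra.
have hn0 : h != 0 by lra.
(* The map [x / (1 + |x|)] sends the line onto []-1, 1[] with inverse [w / (1 - |w|)]; an affine map
   carries this to []u, v[]. The inverse is continuous only inside, as its denominator vanishes at
   the ends. *)
pose f (x : R) := m + h * (x / (1 + `|x|)).
pose w y := (y - m) / h.
pose g (y : R) := w y / (1 - `|w y|).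
have den (x : R) : 0 < 1 + `|x| by rewrite ltr_wpDr.
have ratio (x : R) : `|x / (1 + `|x|)| = `|x| / (1 + `|x|).
  by rewrite normrM normfV (gtr0_norm (den x)).
have wy y : u < y < v -> 0 < 1 - `|w y|.
  move=> /andP[uy yv]; rewrite subr_gt0 /w normrM normfV (gtr0_norm h0).
  rewrite ltr_pdivrMr// mul1r ltr_norml /m /h; apply/andP; split; lra.
have fw x : w (f x) = x / (1 + `|x|) by rewrite /w /f addrAC subrr add0r mulrAC divff// mul1r.
exists f, g; split.
- move=> x; apply: cvgD; first exact: cvg_cst.
  apply: cvgMr; apply: cvgM; first exact: cvg_id.
  apply: cvgV; first by rewrite gt_eqF.
  by apply: cvgD; [exact: cvg_cst|exact: norm_continuous].
- move=> x.
  have : `|x / (1 + `|x|)| < 1 by rewrite ratio ltr_pdivrMr// mul1r ltrDr.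
  rewrite ltr_norml /f => /andP[h1 h2]; move: (x / _) h1 h2 => q h1 h2.
  by apply/andP; split; rewrite /m /h; nra.
- move=> x; rewrite /g fw ratio.
  by field; have := den x; lra.
- move=> y yuv; have wp := wy y yuv; rewrite /f /g.
  have -> : `|w y / (1 - `|w y|)| = `|w y| / (1 - `|w y|).
    by rewrite normrM normfV (gtr0_norm wp).
  have -> : w y / (1 - `|w y|) / (1 + `|w y| / (1 - `|w y|)) = w y by field; lra.
  by rewrite /w; field.
- move=> y yuv; have wp := wy y yuv.
  have cw : {for y, continuous w}.
    by apply: cvgM; [apply: cvgB; [exact: cvg_id|exact: cvg_cst]|exact: cvg_cst].
  apply: cvgM; first exact: cw.
  apply: cvgV; first by rewrite gt_eqF.
  apply: cvgB; first exact: cvg_cst.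
  exact: (@continuous_comp _ _ _ w (fun x => `|x|) y cw (@norm_continuous _ _ _)).
Qed.

Lemma homeo_intro (d : nat) (e : set (R * R)) (f : 'rV[R]_d -> R * R) g :
  continuous f -> f @` setT = e -> (forall v, g (f v) = v) ->
  (forall z, e z -> {for z, continuous g}) -> homeomorphic_to_Rd d e.
Proof.
move=> cf fe gf cg; exists f, g; split => //.
by apply: continuous_in_subspaceT => z; rewrite inE; exact: cg.
Qed.

Lemma set1_cell (z : R * R) : is_cell [set z].
Proof.
exists 0%N => //; apply: (@homeo_intro 0 _ (fun=> z) (fun=> 0)).
- exact: cst_continuous.
- by apply/seteqP; split=> [_ [v _ <-]//|_ ->]; exists 0.
- by move=> v; apply/rowP => -[].
- by move=> w _; exact: cst_continuous.
Qed.

(** A left inverse continuous on the whole plane makes the inverse chart continuous. It will be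
    [rotX] for boundary arcs and a coordinate for dyadic edges. *)
Lemma arc_cell (k : R -> R * R) (l : R * R -> R) (u v : R) : u < v ->
  continuous k -> continuous l -> cancel k l ->
  is_cell (k @` [set t | u < t < v]).
Proof.
move=> uv ck cl kl; have [f [g [cf fuv fg gf cg]]] := open_interval_homeo uv.
exists 1%N => //.
apply: (@homeo_intro 1 _ (fun w => k (f (w ord0 ord0))) (fun z => const_mx (g (l z)))).
- move=> w; apply: (@continuous_comp _ _ _ (fun w : 'rV[R]_1 => f (w ord0 ord0)) k); last exact: ck.
  apply: (@continuous_comp _ _ _ (fun w : 'rV[R]_1 => w ord0 ord0) f); last exact: cf.
  exact: coord_continuous.
- apply/seteqP; split=> [_ [w _ <-]|_ [t tuv <-]].
    by exists (f (w ord0 ord0)) => //=.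
  by exists (const_mx (g t)) => //; rewrite mxE gf.
- by move=> w; apply/rowP => j; rewrite mxE kl fg (ord1 j).
- move=> _ [t tuv <-]; apply: rV_continuous_at => j.
  rewrite (_ : (fun y => _) = g \o l); last by apply/funext => y; rewrite mxE.
  by apply: continuous_comp; [exact: cl|rewrite kl; exact: cg].
Qed.

Lemma box_cell (u v u' v' : R) : u < v -> u' < v' ->
  is_cell [set z | u < z.1 < v /\ u' < z.2 < v'].
Proof.
move=> uv uv'; have [f [g [cf fuv fg gf cg]]] := open_interval_homeo uv.
have [f' [g' [cf' fuv' fg' gf' cg']]] := open_interval_homeo uv'.
exists 2%N => //; pose j1 : 'I_2 := lift ord0 ord0.
apply: (@homeo_intro 2 _ (fun w => (f (w ord0 ord0), f' (w ord0 j1)))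
   (fun z => \row_j (if j == ord0 then g z.1 else g' z.2))).
- move=> w.
  have c1 : {for w, continuous (fun w : 'rV[R]_2 => f (w ord0 ord0))}.
    apply: (@continuous_comp _ _ _ (fun w : 'rV[R]_2 => w ord0 ord0) f); last exact: cf.
    exact: coord_continuous.
  have c2 : {for w, continuous (fun w : 'rV[R]_2 => f' (w ord0 j1))}.
    apply: (@continuous_comp _ _ _ (fun w : 'rV[R]_2 => w ord0 j1) f'); last exact: cf'.
    exact: coord_continuous.
  exact: (cvg_pair c1 c2).
- apply/seteqP; split=> [_ [w _ <-]|[x y] /= [xuv yuv]]; first by split=> /=.
  by exists (\row_j (if j == ord0 then g x else g' y)) => //; rewrite !mxE/= gf// gf'.
- move=> w; apply/rowP => j; rewrite mxE/= fg fg'.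
  case: (unliftP ord0 j) => [i ->|->]; last by rewrite eqxx.
  by rewrite (ord1 i).
- move=> [x y] /= [xuv yuv]; apply: rV_continuous_at => j.
  case: (unliftP ord0 j) => [i ->|->].
    rewrite (_ : (fun y => _) = g' \o snd); last by apply/funext => z; rewrite mxE.
    by apply: continuous_comp; [exact: cvg_snd|exact: cg'].
  rewrite (_ : (fun y => _) = g \o fst); last by apply/funext => z; rewrite mxE eqxx.
  by apply: continuous_comp; [exact: cvg_fst|exact: cg].
Qed.

End CellHomeomorphisms.

(** * Dyadic decompositions *)

Section RefiningPartitions.
Variables (T : Type) (K : countType) (code : nat -> T -> K).
Hypothesis code_refines : forall k x y, code k.+1 x = code k.+1 y -> code k x = code k y.
Variable good : set T -> Prop.

Definition block k x : set T := [set y | code k y = code k x].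

(* With code_refines, the blocks are nested like dyadic intervals; a block of minimal
   level around x is the largest good one containing x. *)
Definition maximal_blocks : set (set T) :=
  [set J | exists k x, [/\ J = block k x, good J
    & forall k', (k' < k)%N -> ~ good (block k' x)]].

Lemma code_refines_le k k' x y : (k <= k')%N ->
  code k' x = code k' y -> code k x = code k y.
Proof.
move=> /subnK <-; elim: (k' - k)%N => [//|m IH]; rewrite addSn => /code_refines.
exact: IH.
Qed.

Lemma block_eq k x y : block k x y -> block k y = block k x.
Proof. by rewrite /block /= => ->. Qed.

Lemma maximal_blocks_countable : countable maximal_blocks.
Proof.
pose F (kc : nat * K) : set T := [set y | code kc.1 y = kc.2].
apply: (@sub_countable _ _ _ (F @` setT)).
  by apply: subset_card_le => J [k [x [-> _ _]]]; exists (k, code k x).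
apply: (@sub_countable _ _ _ [set: nat * K]); first exact: card_image_le.
exact: countableP.
Qed.

(** Blocks that meet are nested. At equal levels they coincide; otherwise the finer one sits in a
    good block of lower level, against its minimality. *)
Lemma maximal_blocks_disjoint J1 J2 : maximal_blocks J1 -> maximal_blocks J2 ->
  J1 <> J2 -> J1 `&` J2 = set0.
Proof.
move=> [k1 [x1 [-> g1 m1]]] [k2 [x2 [-> g2 m2]]] J12.
apply/seteqP; split => // z [z1 z2]; exfalso.
wlog k12 : k1 k2 x1 x2 g1 m1 g2 m2 J12 z1 z2 / (k1 <= k2)%N.
  move=> h; have [k12|k21] := leqP k1 k2; first exact: (h k1 k2 x1 x2).
  by apply: (h k2 k1 x2 x1) => //; [apply: nesym|exact: ltnW].
move: k12; rewrite leq_eqVlt => /predU1P[k12|k12].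
  by subst k2; apply: J12; rewrite -(block_eq z1) -(block_eq z2).
apply: (m2 _ k12); suff -> : block k1 x2 = block k1 x1 by [].
by rewrite -(block_eq z1); apply: block_eq; rewrite /block/=; apply/esym/(code_refines_le (ltnW k12)).
Qed.

Lemma maximal_blocks_cover :
  \bigcup_(J in maximal_blocks) J = [set x | exists k, good (block k x)].
Proof.
apply/seteqP; split=> [x [_ [k [y [-> g _]]] xy]|x [k0 g0]].
  by exists k; rewrite (block_eq xy).
have ex : exists k, `[< good (block k x) >] by exists k0; exact/asboolP.
have [k /asboolP gk mk] := ex_minnP ex.
exists (block k x) => //; exists k, x; split=> // k' k'k g'.
by have := mk k' (introT (asboolP _) g'); rewrite leqNgt k'k.
Qed.

End RefiningPartitions.

Section DyadicIntervals.
Variable R : realType.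
Implicit Types (x y : R) (k : nat).

(* Floor and ceiling together separate the dyadic points of level k from the open
   dyadic intervals between them. *)
Definition dyadic k x : int * int := (Num.floor (x * 2 ^+ k), Num.ceil (x * 2 ^+ k)).

(** Comparing with an integer at level [k] is comparing with an even integer at level [k + 1], so
    the finer floor and ceiling determine the coarser ones. *)
Lemma dyadic_refines k x y : dyadic k.+1 x = dyadic k.+1 y -> dyadic k x = dyadic k y.
Proof.
have dbl (z : R) (m : int) : (m%:~R <= z * 2 ^+ k) = ((m * 2)%:~R <= z * 2 ^+ k.+1).
  by rewrite intrM exprSr mulrA ler_pM2r.
have dbl' (z : R) (m : int) : (z * 2 ^+ k <= m%:~R) = (z * 2 ^+ k.+1 <= (m * 2)%:~R).
  by rewrite intrM exprSr mulrA ler_pM2r.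
have fle (z w : R) : Num.floor (z * 2 ^+ k.+1) = Num.floor (w * 2 ^+ k.+1) ->
    Num.floor (z * 2 ^+ k) <= Num.floor (w * 2 ^+ k).
  by move=> zw; rewrite floor_ge_int dbl -floor_ge_int -zw floor_ge_int -dbl -floor_ge_int.
have cle (z w : R) : Num.ceil (z * 2 ^+ k.+1) = Num.ceil (w * 2 ^+ k.+1) ->
    Num.ceil (z * 2 ^+ k) <= Num.ceil (w * 2 ^+ k).
  by move=> zw; rewrite ceil_le_int dbl' -ceil_le_int zw ceil_le_int -dbl' -ceil_le_int.
by move=> [hf hc]; congr pair; apply/eqP; rewrite eq_le ?fle ?cle.
Qed.

Lemma dyadic_block k x : block dyadic k x = [set x] \/
  exists u v, u < v /\ block dyadic k x = [set y | u < y < v].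
Proof.
have P0 : 0 < (2 : R) ^+ k by rewrite exprn_gt0.
set m := Num.floor (x * 2 ^+ k).
have [xm|xm] := eqVneq (m%:~R) (x * 2 ^+ k).
  left; apply/seteqP; split=> [y [yf yc]|_ ->//] /=.
  apply: (mulIf (lt0r_neq0 P0)); apply/eqP; rewrite eq_le -xm.
  have cm : Num.ceil (x * 2 ^+ k) = m.
    by apply: ceil_def; rewrite -xm lexx andbT ltr_int ltrBlDr ltrDl.
  by rewrite -floor_ge_int yf lexx andbT -ceil_le_int yc cm.
have mx : m%:~R < x * 2 ^+ k < (m + 1)%:~R.
  have /andP[h1 h2] := floor_itv (x * 2 ^+ k).
  by rewrite h2 andbT lt_neqAle xm.
have cm : Num.ceil (x * 2 ^+ k) = m + 1.
  by apply: ceil_def; case/andP: mx => h1 h2; rewrite addrK h1 ltW.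
right; exists (m%:~R / 2 ^+ k), ((m + 1)%:~R / 2 ^+ k); split.
  by rewrite ltr_pM2r ?invr_gt0// ltr_int ltrDl.
apply/seteqP; split=> [y [yf yc]|y] /=.
  rewrite ltr_pdivrMr// ltr_pdivlMr//; apply/andP; split.
    by have := ceil_itv (y * 2 ^+ k); rewrite yc cm addrK => /andP[].
  by have := floor_itv (y * 2 ^+ k); rewrite yf => /andP[].
rewrite ltr_pdivrMr// ltr_pdivlMr// => /andP[h1 h2].
rewrite /block /= /dyadic cm -/m; congr pair.
- by apply: floor_def; rewrite (ltW h1) h2.
- by apply: ceil_def; rewrite addrK h1 ltW.
Qed.

Lemma dyadic_small x (e : R) : 0 < e ->
  exists k, forall y, block dyadic k x y -> `|y - x| < e.
Proof.
(* This [k] satisfies [1 / e < 2 ^ k], and points with equal floors at level [k] differ by less than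
   [1 / 2 ^ k]. *)
move=> e0; pose k := Num.Def.archi_bound (e^-1); exists k => y [yf _].
have P0 : 0 < (2 : R) ^+ k by rewrite exprn_gt0.
have ek : e^-1 < 2 ^+ k by exact: upper_nthrootP.
have ek1 : 1 < e * 2 ^+ k by rewrite -ltr_pdivrMl// mulr1.
have /andP[y1 y2] := floor_itv (y * 2 ^+ k).
have /andP[x1 x2] := floor_itv (x * 2 ^+ k).
rewrite yf in y1 y2; rewrite intrD in x2 y2.
rewrite -(ltr_pM2r P0); apply: lt_trans ek1.
rewrite -[X in _ * X](gtr0_norm P0) -normrM mulrBl ltr_norml.
by apply/andP; split; lra.
Qed.

Lemma dyadic_block_interval k x : is_interval (block dyadic k x).
Proof.
have [->|[u [v [_ ->]]]] := dyadic_block k x.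
  move=> y z /= -> -> w /andP[h1 h2]; apply/eqP; by rewrite eq_le h2 h1.
move=> y z /= /andP[uy yv] /andP[uz zv] w /andP[yw wz].
by rewrite (lt_le_trans uy yw) (le_lt_trans wz zv).
Qed.

Definition dyadic2 k (z : R * R) : (int * int) * (int * int) := (dyadic k z.1, dyadic k z.2).

Lemma dyadic2_refines k z w : dyadic2 k.+1 z = dyadic2 k.+1 w -> dyadic2 k z = dyadic2 k w.
Proof.
move=> /pair_equal_spec[h1 h2].
by rewrite /dyadic2 (dyadic_refines h1) (dyadic_refines h2).
Qed.

Lemma block_dyadic2 k z : block dyadic2 k z =
  [set w | block dyadic k z.1 w.1 /\ block dyadic k z.2 w.2].
Proof.
apply/seteqP; split=> w; rewrite /block /dyadic2 /=.
  by move=> /pair_equal_spec.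
by move=> [-> ->].
Qed.

Lemma dyadic2_convex k z z1 z2 : block dyadic2 k z z1 -> block dyadic2 k z z2 ->
  seg z1 z2 `<=` block dyadic2 k z.
Proof.
rewrite block_dyadic2 => -[h11 h12] [h21 h22] _ [l /andP[l0 l1] ->].
have conv (J : set R) a b : is_interval J -> J a -> J b -> J (a + l * (b - a)).
  move=> iJ Ja Jb; have [ab|/ltW ba] := leP a b.
    by apply: (iJ a b) => //; apply/andP; split; nra.
  by apply: (iJ b a) => //; apply/andP; split; nra.
by split; apply: conv => //; exact: dyadic_block_interval.
Qed.

(** The four cases are a vertex, a vertical edge, a horizontal edge and an open square. *)
Lemma dyadic2_cell k z : is_cell (block dyadic2 k z).
Proof.
rewrite block_dyadic2.
have [->|[u [v [uv ->]]]] := dyadic_block k z.1;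
have [->|[u' [v' [uv' ->]]]] := dyadic_block k z.2.
- rewrite (_ : mkset _ = [set z]); first exact: set1_cell.
  apply/seteqP; split=> [[x y] /= [-> ->]|_ ->//].
  by rewrite -surjective_pairing.
- rewrite (_ : mkset _ = (fun t => (z.1, t)) @` [set t | u' < t < v']).
    apply: (@arc_cell _ _ snd) => //; last by move=> w; exact: cvg_snd.
    by move=> t; apply: (@cvg_pair _ _ _ _ (nbhs z.1) (nbhs t)); [exact: cvg_cst|exact: cvg_id].
  apply/seteqP; split=> [[x y] /= [-> yuv]|_ [t tuv <-]//].
  by exists y.
- rewrite (_ : mkset _ = (fun t => (t, z.2)) @` [set t | u < t < v]).
    apply: (@arc_cell _ _ fst) => //; last by move=> w; exact: cvg_fst.
    by move=> t; apply: (@cvg_pair _ _ _ _ (nbhs t) (nbhs z.2)); [exact: cvg_id|exact: cvg_cst].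
  apply/seteqP; split=> [[x y] /= [xuv ->]|_ [t tuv <-]//].
  by exists x.
- exact: box_cell.
Qed.

Lemma dyadic2_small z (N : set (R * R)) : nbhs z N -> exists k, block dyadic2 k z `<=` N.
Proof.
move=> /nbhs_enorm[e e0 he].
have e20 : 0 < e / 2 by lra.
have [k1 hk1] := dyadic_small z.1 e20; have [k2 hk2] := dyadic_small z.2 e20.
exists (maxn k1 k2) => w; rewrite block_dyadic2 => -[h1 h2]; apply: he.
apply: le_lt_trans (enorm_le_abs _) _.
have h1' : `|(w - z).1| < e / 2.
  apply: hk1; exact: (code_refines_le dyadic_refines (leq_maxl k1 k2) h1).
have h2' : `|(w - z).2| < e / 2.
  apply: hk2; exact: (code_refines_le dyadic_refines (leq_maxr k1 k2) h2).
lra.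
Qed.

End DyadicIntervals.

(** * Tame decompositions *)

Section TameDecompositions.
Variables (R : realType) (X : set (R * R)).
Implicit Types (Y e : set (R * R)).

(** Tameness refers to the fixed region [X], so decompositions of disjoint parts can be united. *)
Definition tame_decomposable Y : Prop :=
  exists C, cell_decomposition Y C /\ forall e, C e -> tame X e.

Lemma tame_decomposable_bigcup (I : countType) (Y : I -> set (R * R)) :
  (forall i j, i <> j -> Y i `&` Y j = set0) ->
  (forall i, tame_decomposable (Y i)) -> tame_decomposable (\bigcup_i Y i).
Proof.
move=> disjY /choice[C hC]; exists (\bigcup_i C i); split; last first.
  by move=> e [i _ Cie]; have [_] := hC i; exact.
have sub i e : C i e -> e `<=` Y i.
  by move=> Cie z ez; have [[_ _ _ <-] _] := hC i; exists e.
split.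
- by apply: bigcup_countable => // i _; have [[]] := hC i.
- by move=> e [i _ Cie]; have [[_ cells _ _] _] := hC i; exact: cells.
- move=> e1 e2 [i _ C1] [j _ C2] e12; have [ij|ij] := eqVneq i j.
    by subst j; have [[_ _ disj _] _] := hC i; exact: disj.
  apply/seteqP; split=> // z [z1 z2].
  by have := disjY i j (elimN eqP ij) => <-; split; [exact: (sub i e1)|exact: (sub j e2)].
- apply/seteqP; split=> [z [e [i _ Cie] ez]|z [i _ Yiz]].
    by exists i => //; exact: sub ez.
  have [[_ _ _ Yi] _] := hC i; move: Yiz; rewrite -Yi => -[e Cie ez].
  by exists e => //; exists i.
Qed.

Lemma tame_decomposable_countable Y : Y `<=` X -> countable Y -> tame_decomposable Y.
Proof.
move=> YX cY; exists (set1 @` Y); split.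
  split.
  - by apply: sub_countable cY; exact: card_image_le.
  - by move=> _ [z _ <-]; exact: set1_cell.
  - move=> _ _ [z _ <-] [w _ <-] zw; apply/seteqP; split=> // v [/= -> vw].
    by apply: zw; rewrite vw.
  - by apply/seteqP; split=> [z [_ [w Yw <-] ->//]|z Yz]; exists [set z] => //; exists z.
by move=> _ [z Yz <-] A B gamma a b; apply: set1_interacts; exact: YX.
Qed.

Lemma tame_decomposable_open Y : open Y -> Y `<=` X -> tame_decomposable Y.
Proof.
move=> oY YX; pose good e := e `<=` Y.
exists (maximal_blocks (@dyadic2 R) good); split.
  split.
  - exact: maximal_blocks_countable.
  - by move=> _ [k [x [-> _ _]]]; exact: dyadic2_cell.
  - by apply: maximal_blocks_disjoint; exact: dyadic2_refines.
  - rewrite maximal_blocks_cover; apply/seteqP; split=> [z [k]|z Yz]; first exact.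
    by apply: dyadic2_small; exact: open_nbhs_nbhs.
move=> _ [k [x [-> g _]]] A B gamma a b gs.
apply: (convex_interacts gs); first exact: subset_trans g YX.
by move=> z w; exact: dyadic2_convex.
Qed.

(** By hypothesis every parameter of [V] has a good dyadic block around it, so the maximal good
    blocks cover [V]; injectivity of [Gam] carries disjointness over to the arcs. *)
Lemma tame_decomposable_arc (p : {poly R}) (th : R) (V : set R) :
  (forall t, V t -> exists2 rho : R, 0 < rho & forall J, is_interval J ->
     (forall x, J x -> `|x - t| < rho) -> J `<=` V /\ tame X (Gam p th @` J)) ->
  tame_decomposable (Gam p th @` V).
Proof.
move=> hV; pose good J := J `<=` V /\ tame X (Gam p th @` J).
pose D := maximal_blocks (@dyadic R) good.
have cover : \bigcup_(J in D) J = V.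
  rewrite maximal_blocks_cover; apply/seteqP; split=> [t [k [JV _]]|t Vt]; first exact: JV.
  have [rho rho0 hrho] := hV t Vt; have [k hk] := dyadic_small t rho0.
  by exists k; apply: hrho hk; exact: dyadic_block_interval.
exists ((fun J => Gam p th @` J) @` D); split; last first.
  by move=> _ [J [k [x [_ [_ tJ] _]]] <-].
split.
- apply: (@sub_countable _ _ _ D); first exact: card_image_le.
  exact: maximal_blocks_countable.
- move=> _ [_ [k [x [-> _ _]]] <-].
  have [->|[u [v [uv ->]]]] := dyadic_block k x.
    by rewrite image_set1; exact: set1_cell.
  apply: (arc_cell uv) (rotX_Gam p th); last exact: rotX_continuous.
  move=> t; rewrite (_ : Gam _ _ = fun t => ((Gam1 p th).[t], (Gam2 p th).[t])).
    exact: (cvg_pair (@horner_continuous_at _ (Gam1 p th) t)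
                     (@horner_continuous_at _ (Gam2 p th) t)).
  by apply/funext => s; rewrite GamE.
- move=> _ _ [J1 D1 <-] [J2 D2 <-] J12.
  have J12' : J1 <> J2 by move=> E; apply: J12; rewrite E.
  have := maximal_blocks_disjoint (@dyadic_refines R) D1 D2 J12'.
  move=> /seteqP[dis _]; apply/seteqP; split=> // _ [[x J1x <-] [y J2y yx]].
  apply: (dis x); split=> //.
  by rewrite -(rotX_Gam p th x) -yx rotX_Gam.
- rewrite -cover; apply/seteqP; split=> [z [_ [J DJ <-] [t Jt <-]]|_ [t [J DJ Jt] <-]].
    by exists t => //; exists J.
  by exists (Gam p th @` J); [exists J|exists t].
Qed.

End TameDecompositions.

(** * Decomposition of the whole region *)

Lemma roots_finite (R : realType) (q : {poly R}) : q != 0 -> finite_set [set x | q.[x] = 0].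
Proof.
move=> q0; apply: contrapT => inf.
have [B Bq sB] := infinite_set_fset (size q) inf.
have := max_poly_roots q0 (_ : all (root q) (finmap.enum_fset B)) (finmap.fset_uniq B).
rewrite ltnNge sB => /(_ _)/notF; apply.
by apply/allP => x xB; apply/rootP; exact: Bq.
Qed.

Section PolynomialRegion.
Variables (R : realType) (n : nat) (p : 'I_n -> {poly R}) (th : 'I_n -> R).
Let X := \bigcap_(i in setT) poly_half_plane (p i) (th i).
Let cr i j := crossing (p i) (th i) (p j) (th j).
Let G i := Gam (p i) (th i).

Let interior_part : set (R * R) := [set z | forall i, 0 < Phi (p i) (th i) z].

(* Points of the i-th curve lying on no earlier one, so that each boundary point is
   counted once. *)
Let first_on i : set R := [set t | X (G i t) /\ forall j : 'I_n, (j < i)%N -> (cr i j).[t] != 0].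

(** The first two clauses are those of [arc_tame] and persist near [t]; the third discards a curve
    contained in an earlier one. *)
Let regular i : set R := [set t |
  [/\ deriv (deriv (p i)) = 0 \/ (deriv (deriv (p i))).[t] != 0,
      forall j, cr i j = 0 \/ 0 < (cr i j).[t]
    & forall j : 'I_n, (j < i)%N -> cr i j != 0]].

Lemma regular_first_on i : regular i `<=` first_on i.
Proof.
move=> t [_ h2 h3]; split; first exact: crossing_in.
move=> j ji; have [cj0|cj] := h2 j; last by rewrite gt_eqF.
by have := h3 j ji; rewrite -/(cr i j) cj0 eqxx.
Qed.

(** Regularity can fail on [first_on i] only at a root of a nonzero polynomial among [p_i''] and the
    crossings. *)
Lemma irregular_finite i : finite_set (first_on i `\` regular i).
Proof.
pose Z (q : {poly R}) := [set x | q != 0 /\ q.[x] = 0].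
have fZ q : finite_set (Z q).
  have [q0|q0] := eqVneq q 0.
    by apply: (@sub_finite_set _ _ set0) => // x [/eqP].
  by apply: sub_finite_set (roots_finite q0) => x [].
apply: (@sub_finite_set _ _
   (Z (deriv (deriv (p i))) `|` \bigcup_(j in [set: 'I_n]) Z (cr i j))); last first.
  by rewrite finite_setU; split=> //; apply: bigcup_finite => //; exact: finite_finset.
move=> t [[Xt nz] irr]; apply: contrapT => nZ; apply: irr.
split.
- have [p0|p0] := eqVneq (deriv (deriv (p i))) 0; [by left|right].
  by apply/eqP => pt; apply: nZ; left.
- move=> j; have [cj0|cj0] := eqVneq (cr i j) 0; [by left|right].
  rewrite lt_neqAle; apply/andP; split; last by have := Xt j I; rewrite /cr crossingE.
  by rewrite eq_sym; apply/eqP => ct; apply: nZ; right; exists j.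
- by move=> j /nz; apply: contra => /eqP ->; rewrite horner0.
Qed.

Lemma tame_decomposable_first_on i : tame_decomposable X (G i @` first_on i).
Proof.
pose Y (b : bool) := G i @` (if b then regular i else first_on i `\` regular i).
have -> : G i @` first_on i = \bigcup_b Y b.
  apply/seteqP; split=> [_ [t ft <-]|_ [b _ [t bt <-]]].
    have [rt|rt] := pselect (regular i t).
      by exists true => //; exists t.
    by exists false => //; exists t.
  by exists t => //; case: b bt => [/regular_first_on|[]].
have inj : injective (G i).
  by move=> x y xy; rewrite -(rotX_Gam (p i) (th i) x) -/(G i) xy rotX_Gam.
apply: tame_decomposable_bigcup => [b1 b2 b12|[]].
- apply/seteqP; split=> // _ [[x xb <-] [y yb /inj yx]]; subst y.
  by case: b1 b2 b12 xb yb => [] []//= _; [move=> r [_]|move=> [_ nr]].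
- apply: tame_decomposable_arc => t [h1 h2 h3].
  (* The regular set is open, so short intervals about [t] stay inside it. *)
  have [e e0 he] := near_dist_lt (near_crossing h2).
  have [e' e'0 he'] : exists2 e : R, 0 < e & forall x, `|x - t| < e ->
      deriv (deriv (p i)) = 0 \/ (deriv (deriv (p i))).[x] != 0.
    have [p0|p0] := eqVneq (deriv (deriv (p i))) 0.
      by exists 1 => // x _; left.
    have : (deriv (deriv (p i))).[t] != 0 by case: h1 => // E; rewrite E eqxx in p0.
    rewrite neq_lt => /orP[] pt.
      have [e' e'0 he'] := near_dist_lt (nbhs_lt_continuous (@horner_continuous_at _ _ t) pt).
      by exists e' => // x /he' px; right; rewrite lt_eqF.
    have [e' e'0 he'] := near_dist_lt (nbhs_gt_continuous (@horner_continuous_at _ _ t) pt).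
    by exists e' => // x /he' px; right; rewrite gt_eqF.
  have [rho rho0 hrho] := arc_tame h1 h2.
  exists (Num.min rho (Num.min e e')); first by rewrite !lt_min rho0 e0.
  move=> J iJ Jr; split.
    by move=> x /Jr; rewrite !lt_min => /and3P[_ /he ? /he' ?]; split.
  by apply: hrho => // x /Jr; rewrite lt_min => /andP[].
- apply: tame_decomposable_countable; first by move=> _ [t [[Xt _] _] <-].
  apply: finite_set_countable; apply: finite_image; exact: irregular_finite.
Qed.

Lemma tame_decomposable_region : tame_decomposable X X.
Proof.
pose Y (o : option 'I_n) := if o is Some i then G i @` first_on i else interior_part.
have {2}-> : X = \bigcup_o Y o.
  apply/seteqP; split=> [z Xz|z [[i|] _]]; last 2 first.
  - by move=> [t [Xt _] <-].
  - by move=> h j _; exact: ltW.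
  have [hz|hz] := pselect (interior_part z); first by exists None.
  (* The point is assigned to the least index whose [Phi] vanishes there, as [first_on] requires. *)
  have ex : exists m, [exists i : 'I_n, (i == m :> nat) && (Phi (p i) (th i) z == 0)].
    apply: contrapT => nex; apply: hz => i; rewrite lt_neqAle.
    apply/andP; split; last exact: (Xz i I).
    apply/eqP => Pz; apply: nex; exists i; apply/existsP; exists i.
    by rewrite eqxx -Pz eqxx.
  have [m /existsP[i /andP[/eqP im /eqP Pz]] mmin] := ex_minnP ex.
  have Gz := Gam_rotX Pz.
  exists (Some i) => //; exists (rotX (th i) z) => //; split.
    by rewrite /G Gz.
  move=> j ji; rewrite /cr crossingE Gz; apply/eqP => Pj.
  have := mmin j; rewrite -im leqNgt ji => /(_ _)/notF; apply.
  by apply/existsP; exists j; rewrite eqxx Pj eqxx.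
have Gdis (i j : 'I_n) : (j < i)%N -> G i @` first_on i `&` G j @` first_on j = set0.
  move=> ji; apply/seteqP; split=> // _ [[x [_ nx] <-] [y _ yx]].
  by have := nx j ji; rewrite /cr crossingE -/(G i) -yx Phi_Gam eqxx.
have Udis i : G i @` first_on i `&` interior_part = set0.
  by apply/seteqP; split=> // _ [[x _ <-] /(_ i)]; rewrite Phi_Gam ltxx.
apply: tame_decomposable_bigcup.
- move=> [i|] [j|] // ij; last by rewrite setIC; exact: Udis.
    have [lt|lt|E] := ltngtP i j; [|exact: Gdis|].
      by rewrite setIC; exact: Gdis.
    by case: ij; congr Some; exact: val_inj.
  exact: Udis.
- move=> [i|]; first exact: tame_decomposable_first_on.
  apply: tame_decomposable_open; last by move=> z h j _; exact: ltW.
  rewrite openE => z hz; rewrite /interior.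
  apply: (@filter_forall _ _ (fun j w => 0 < Phi (p j) (th j) w) (nbhs z)) => j.
  exact: (nbhs_gt_continuous (@Phi_continuous _ (p j) (th j) z) (hz j)).
Qed.

End PolynomialRegion.

Theorem theorem3p7 (R : realType) (n : nat) (H : 'I_n -> set (R * R)) :
  (0 < n)%N ->
  (forall i, is_closed_poly_half_plane (H i)) ->
  injective H ->
  exists C : set (set (R * R)),
    cell_decomposition (\bigcap_(i in setT) H i) C /\
    forall (A B : R * R) (gamma : R -> R * R) (a b : R),
      shortest_curve (\bigcap_(i in setT) H i) A B gamma a b ->
      forall e, C e -> interacts_finitely gamma a b e.
Proof.
move=> _ /choice[p /choice[th HE]] _.
have -> : \bigcap_(i in setT) H i = \bigcap_(i in setT) poly_half_plane (p i) (th i).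
  by apply: eq_bigcapr => i _; exact: HE.
have [C [CX tC]] := tame_decomposable_region p th.
exists C; split=> // A B gamma a b gs e Ce.
exact: (tC e Ce A B).
Qed.
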